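(* Let $d\ge 2$ be an integer. For all real $M>0$ and all positive integers $q$, $$\sup_{K\in\mathcal K_d^1}\ \sup_{f\in\mathcal F(K,M)}\mathbb E_f\left[R_n^q\right]=O\left(\sup_{K\in\mathcal K_d^1}\mathbb E_K\left[R_n^q\right]\right),$$ that is, the ratio of the left-hand side to $\sup_{K\in\mathcal K_d^1}\mathbb E_K[R_n^q]$ is bounded independently of the integer $n\ge 1$.
   Context: A convex body in $\mathbb R^d$ is a compact convex set with nonempty interior. $\mathcal K_d^1$ is the class of all convex bodies in $\mathbb R^d$ included in the closed unit Euclidean ball centered at $0$. For $K\in\mathcal K_d^1$ and $M>0$, $\mathcal F(K,M)$ is the collection of all probability densities (with respect to Lebesgue measure) that are supported on $K$ (vanish outside $K$) and are bounded by $M$; a supremum over an empty collection is taken to be $0$. $\mathbb E_f$ is expectation when $X_1,\dots,X_n$ are i.i.d. with density $f$, and $\mathbb E_K$ is expectation when they are i.i.d. uniformly distributed in $K$. $R_n$ is the number of vertices of the convex hull of $X_1,\dots,X_n$. *)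

(* Defs.v *)
From HB Require Import structures.
From mathcomp Require Import all_boot all_order all_algebra finmap.
From mathcomp Require Import all_classical all_reals all_analysis.
From mathcomp Require Import measurable_realfun.

Set Implicit Arguments.
Unset Strict Implicit.
Unset Printing Implicit Defensive.

Import Order.TTheory GRing.Theory Num.Theory.
Import numFieldNormedType.Exports.

Local Open Scope classical_set_scope.
Local Open Scope ring_scope.

Section product_cons.
Local Open Scope ereal_scope.
Context d (T : measurableType d) (R : realType) (n : nat).

Definition cons_pair (x : T * n.-tuple T) : n.+1.-tuple T := cons_tuple x.1 x.2.

Definition uncons (t : n.+1.-tuple T) : T * n.-tuple T :=
  (thead t, behead_tuple t).

Lemma measurable_cons_pair : measurable_fun setT cons_pair.
Proof. exact: (measurable_cons measurable_fst measurable_snd). Qed.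

Lemma measurable_uncons : measurable_fun setT uncons.
Proof.
by apply/measurable_fun_pair; [exact: measurable_tnth|exact: measurable_behead].
Qed.

Lemma cons_pairK : cancel cons_pair uncons.
Proof. by move=> [x t]; rewrite /uncons theadE; congr pair; exact/val_inj. Qed.

Lemma unconsK : cancel uncons cons_pair.
Proof. by move=> t; apply/val_inj; rewrite /= [in RHS](tuple_eta t). Qed.

Definition product_cons (m1 : set T -> \bar R) (m2 : set (n.-tuple T) -> \bar R)
    : set (n.+1.-tuple T) -> \bar R :=
  pushforward (m1 \x m2) cons_pair.

Section measure.
Variables (m1 : {sigma_finite_measure set T -> \bar R})
  (m2 : {sigma_finite_measure set (n.-tuple T) -> \bar R}).

Let mpre A : measurable A -> measurable (cons_pair @^-1` A).
Proof.
by move=> mA; rewrite -[X in measurable X]setTI; exact: measurable_cons_pair.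
Qed.

Let product_cons0 : product_cons m1 m2 set0 = 0.
Proof. by rewrite /product_cons /pushforward preimage_set0 measure0. Qed.

Let product_cons_ge0 A : 0 <= product_cons m1 m2 A.
Proof. by rewrite /product_cons /pushforward measure_ge0. Qed.

Let product_cons_sigma_additive : semi_sigma_additive (product_cons m1 m2).
Proof.
move=> F mF tF mUF; rewrite /product_cons /pushforward preimage_bigcup.
apply: measure_semi_sigma_additive.
- by move=> k; exact: mpre.
- apply/trivIsetP => /= i j _ _ ij; rewrite -preimage_setI.
  by move/trivIsetP : tF => /(_ _ _ _ _ ij) ->//; rewrite preimage_set0.
- by rewrite -preimage_bigcup; exact: mpre.
Qed.

HB.instance Definition _ := isMeasure.Build _ _ _ (product_cons m1 m2)
  product_cons0 product_cons_ge0 product_cons_sigma_additive.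

Let product_cons_sigma_finite : sigma_finite setT (product_cons m1 m2).
Proof.
have /sigma_finiteP[F [UF ndF Foo]] := sigma_finiteT m1.
have /sigma_finiteP[G [UG ndG Goo]] := sigma_finiteT m2.
exists (fun k => uncons @^-1` (F k `*` G k)) => [|k].
  rewrite -preimage_bigcup (_ : \bigcup_k _ = setT) ?preimage_setT//.
  rewrite -setXTT UF UG predeqE => -[x y]; split.
    by move=> [k _ []/= ? ?]; split; exists k.
  move=> [/= [i _ Fix] [j _ Gjy]]; exists (maxn i j) => //; split.
  - by move: x Fix; exact/subsetPset/ndF/leq_maxl.
  - by move: y Gjy; exact/subsetPset/ndG/leq_maxr.
have [mF Fk] := Foo k; have [mG Gk] := Goo k; split.
  by rewrite -[X in measurable X]setTI; apply: measurable_uncons => //;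
    exact: measurableX.
rewrite /product_cons /pushforward -comp_preimage (_ : _ \o _ = id).
  by rewrite preimage_id product_measure1E// lte_mul_pinfty// ge0_fin_numE.
by apply/funext => x; exact: cons_pairK.
Qed.

HB.instance Definition _ := Measure_isSigmaFinite.Build _ _ _
  (product_cons m1 m2) product_cons_sigma_finite.

Lemma product_consE A (B : 'I_n -> set T) : measurable A ->
  measurable [set t : n.-tuple T | forall i, B i (tnth t i)] ->
  product_cons m1 m2 [set t | A (thead t) /\ forall i, B i (tnth t (lift ord0 i))]
    = m1 A * m2 [set t | forall i, B i (tnth t i)].
Proof.
move=> mA mB; rewrite -product_measure1E// /product_cons /pushforward.
congr (product_measure1 _ _ _).
apply/seteqP; split=> [[x t]/= [Ax Bt]|[x t]/= [Ax Bt]]; split => // i.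
- by have := Bt i; rewrite tnthS; congr (B i (tnth _ _)); exact/val_inj.
- by have := Bt i; rewrite tnthS; congr (B i (tnth _ _)); exact/val_inj.
Qed.

End measure.
End product_cons.

Section power_measure.
Local Open Scope ereal_scope.
Context d (T : measurableType d) (R : realType).

Section def.
Variable m : set T -> \bar R.

(* The n-fold product measure m \x ... \x m, see [power_measure_box]. *)
Fixpoint power_measure n : set (n.-tuple T) -> \bar R :=
  match n with
  | 0 => \d_[tuple]
  | n'.+1 => product_cons m (power_measure (n := n'))
  end.

End def.

Section structure.
Variable m : {sigma_finite_measure set T -> \bar R}.

Lemma power_measure_struct n :
  {mu : {sigma_finite_measure set (n.-tuple T) -> \bar R} |
     mu = @power_measure m n :> (set (n.-tuple T) -> \bar R)}.
Proof.
elim: n => [|n [mu mu_eq]].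
  by exists (\d_[tuple] : {sigma_finite_measure set (0.-tuple T) -> \bar R}).
exists (product_cons m mu : {sigma_finite_measure set (n.+1.-tuple T) -> \bar R}).
by rewrite /= -mu_eq.
Qed.

Variable n : nat.

Let power_measure0 : @power_measure m n set0 = 0.
Proof. by have [mu <-] := power_measure_struct n; exact: measure0. Qed.

Let power_measure_ge0 A : 0 <= @power_measure m n A.
Proof. by have [mu <-] := power_measure_struct n; exact: measure_ge0. Qed.

Let power_measure_sigma_additive : semi_sigma_additive (@power_measure m n).
Proof.
by have [mu <-] := power_measure_struct n; exact: measure_semi_sigma_additive.
Qed.

HB.instance Definition _ := isMeasure.Build _ _ _ (@power_measure m n)
  power_measure0 power_measure_ge0 power_measure_sigma_additive.

Let power_measure_sigma_finite : sigma_finite setT (@power_measure m n).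
Proof. by have [mu <-] := power_measure_struct n; exact: sigma_finiteT. Qed.

HB.instance Definition _ := Measure_isSigmaFinite.Build _ _ _
  (@power_measure m n) power_measure_sigma_finite.

End structure.

Lemma measurable_box n (A : 'I_n -> set T) : (forall i, measurable (A i)) ->
  measurable [set t : n.-tuple T | forall i, A i (tnth t i)].
Proof.
move=> mA.
rewrite (_ : mkset _ = \bigcap_(i in [set: 'I_n]) (@tnth n T ^~ i @^-1` A i)).
  apply: fin_bigcap_measurable => // i _.
  by rewrite -[X in measurable X]setTI; exact: measurable_tnth.
by apply/seteqP; split=> t /= At i; [move=> _; exact: At|exact: (At i I)].
Qed.

Lemma power_measure_box (m : {sigma_finite_measure set T -> \bar R}) n
    (A : 'I_n -> set T) : (forall i, measurable (A i)) ->
  power_measure m [set t : n.-tuple T | forall i, A i (tnth t i)] =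
  \prod_(i < n) m (A i).
Proof.
elim: n A => [A _|n IH A mA].
  rewrite big_ord0/= diracE mem_set//; case=> //.
rewrite big_ord_recl -IH; last by move=> i; exact: mA.
have mB : measurable [set t : n.-tuple T | forall i, A (lift ord0 i) (tnth t i)].
  exact: (@measurable_box n (fun i => A (lift ord0 i)) (fun i => mA _)).
rewrite -(@product_consE _ _ _ _ m (power_measure m (n := n)) _
  (fun i => A (lift ord0 i)) (mA ord0) mB).
congr (power_measure _ _); apply/seteqP; split => t /=.
  by move=> At; split => [|i]; exact: At.
by move=> [At0 At] i; case: (unliftP ord0 i) => [j|] ->.
Qed.

End power_measure.
Arguments power_measure {d T R} m n _.

Definition measure_rV_display : measure_display.
Proof. exact: (measure_tuple_display default_measure_display). Qed.

Section measurable_rV.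
Context (R : realType) (d : nat).

Definition rV_coord (i : 'I_d) (x : 'rV[R]_d) : measurableTypeR R := x ord0 i.

(* The sigma-algebra generated by the coordinates is the Borel one: see
   [open_measurable_rV] for the nontrivial inclusion. *)
Let rV_set0 : g_sigma_preimage rV_coord set0.
Proof. exact: sigma_algebra0. Qed.

Let rV_setC A : g_sigma_preimage rV_coord A -> g_sigma_preimage rV_coord (~` A).
Proof. exact: sigma_algebraC. Qed.

Let rV_bigcup (F : _^nat) : (forall i, g_sigma_preimage rV_coord (F i)) ->
  g_sigma_preimage rV_coord (\bigcup_i (F i)).
Proof. exact: sigma_algebra_bigcup. Qed.

HB.instance Definition _ := @isMeasurable.Build measure_rV_display
  'rV[R]_d (g_sigma_preimage rV_coord) rV_set0 rV_setC rV_bigcup.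

Lemma measurable_rV_coord i : measurable_fun setT (rV_coord i).
Proof.
move=> _ Y mY; rewrite setTI; apply: sub_sigma_algebra => /=.
rewrite -bigcup_seq/=; exists i => /=; first by rewrite mem_index_enum.
by exists Y => //; rewrite setTI.
Qed.

Lemma measurable_rVP d' (T : measurableType d') (f : T -> 'rV[R]_d) :
  measurable_fun setT f <->
  forall i, measurable_fun setT (rV_coord i \o f).
Proof.
split=> [mf i|mf].
  by apply: measurableT_comp => //; exact: measurable_rV_coord.
suff : g_sigma_preimage rV_coord `<=` [set A | measurable (f @^-1` A)].
  by move=> sub _ A mA; rewrite setTI; exact: sub.
apply: smallest_sub.
  split=> /= [|A mA|F mF].
  - by rewrite preimage_set0.
  - by rewrite setTD preimage_setC; exact: measurableC.
  - by rewrite preimage_bigcup; exact: bigcupT_measurable.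
rewrite -bigcup_seq; apply: bigcup_sub => i _ _ [Y mY <-] /=.
rewrite setTI -comp_preimage -[X in measurable X]setTI.
exact: mf.
Qed.

Lemma measurable_rV_box (A : 'I_d -> set R) :
  (forall i, measurable (A i : set (measurableTypeR R))) ->
  measurable [set x : 'rV[R]_d | forall i, A i (x ord0 i)].
Proof.
move=> mA.
rewrite (_ : mkset _ = \bigcap_(i in [set: 'I_d]) (rV_coord i @^-1` A i)).
  apply: fin_bigcap_measurable => // i _.
  by rewrite -[X in measurable X]setTI; exact: measurable_rV_coord.
by apply/seteqP; split=> t /= At i; [move=> _; exact: At|exact: (At i I)].
Qed.

Lemma ball_rVE (x : 'rV[R]_d) (e : R) : 0 < e ->
  ball x e = [set y : 'rV[R]_d | forall i, ball (x ord0 i) e (y ord0 i)].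
Proof.
move=> e0; apply/seteqP; split=> y /=.
  by move=> [_ xy] i; exact: xy.
by move=> xy; split=> // i j; rewrite ord1; exact: xy.
Qed.

Lemma open_measurable_rV (U : set 'rV[R]_d) : open U -> measurable U.
Proof.
move=> oU.
pose B (p : 'rV[rat]_d * nat) : set 'rV[R]_d :=
  ball (map_mx ratr p.1 : 'rV[R]_d) (p.2.+1%:R^-1).
have mB p : measurable (B p).
  rewrite /B ball_rVE ?invr_gt0//.
  apply: (@measurable_rV_box (fun i => ball ((map_mx ratr p.1 : 'rV[R]_d) ord0 i) _)) => i.
  exact: measurable_ball.
rewrite (_ : U = \bigcup_(p in [set p | B p `<=` U]) B p); last first.
  apply/seteqP; split=> [x Ux|x [p /= +]]; last exact.
  have /nbhs_ballP[e /= e0 xeU] : nbhs x U by exact: open_nbhs_nbhs.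
  have [n ne] : exists n : nat, n.+1%:R^-1 < e / 2.
    have [k _ kP] := near_infty_natSinv_lt (PosNum (divr_gt0 e0 (ltr0n _ 2))).
    by exists k; exact: (kP k (leqnn k)).
  have n0 : 0 < n.+1%:R^-1 :> R by rewrite invr_gt0.
  have q_ i : {q : rat | ball (ratr q : R) n.+1%:R^-1 (x ord0 i)}.
    apply: cid.
    have [q] : exists q : rat, ratr q \in `](x ord0 i), (x ord0 i + n.+1%:R^-1)[.
      by apply: rat_in_itvoo; rewrite ltrDl.
    rewrite in_itv/= => /andP[xq qx]; exists q.
    by rewrite /ball/= ger0_norm ?subr_ge0 1?ltW// ltrBlDl.
  have Bx : B (\row_i sval (q_ i), n) x.
    rewrite /B ball_rVE//= => i; rewrite !mxE; exact: (svalP (q_ i)).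
  exists (\row_i sval (q_ i), n) => //= y By; apply: xeU.
  have -> : e = e / 2 + e / 2 by rewrite -splitr.
  apply: (@ball_triangle _ _ (map_mx ratr (\row_i sval (q_ i)) : 'rV[R]_d)).
  - by apply/ball_sym/(le_ball (ltW ne)).
  - exact: (le_ball (ltW ne)).
rewrite bigcup_mkcond; apply: countable_bigcupT_measurable => // p.
by case: ifPn.
Qed.

End measurable_rV.

Section lebesgue_rV.
Local Open Scope ereal_scope.
Context (R : realType) (d : nat).

Definition rV_of_tuple (t : d.-tuple (measurableTypeR R)) : 'rV[R]_d :=
  (\row_i tnth t i)%R.

Definition tuple_of_rV (x : 'rV[R]_d) : d.-tuple (measurableTypeR R) :=
  [tuple x ord0 i | i < d].

Lemma rV_of_tupleK : cancel rV_of_tuple tuple_of_rV.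
Proof. by move=> t; apply: eq_from_tnth => i; rewrite tnth_mktuple mxE. Qed.

Lemma measurable_rV_of_tuple : measurable_fun setT rV_of_tuple.
Proof.
apply/measurable_rVP => i; rewrite (_ : _ \o _ = (@tnth _ _ ^~ i)).
  exact: measurable_tnth.
by apply/funext => t /=; rewrite /rV_coord mxE.
Qed.

Lemma measurable_tuple_of_rV : measurable_fun setT tuple_of_rV.
Proof.
apply/measurable_fun_tnthP => i; rewrite (_ : _ \o _ = rV_coord i).
  exact: measurable_rV_coord.
by apply/funext => x /=; rewrite tnth_mktuple.
Qed.

Definition lebesgue_rV : set 'rV[R]_d -> \bar R :=
  pushforward (power_measure (@lebesgue_measure R) d) rV_of_tuple.

Let mpre A : measurable A -> measurable (rV_of_tuple @^-1` A).
Proof.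
by move=> mA; rewrite -[X in measurable X]setTI; exact: measurable_rV_of_tuple.
Qed.

Let lebesgue_rV0 : lebesgue_rV set0 = 0.
Proof. by rewrite /lebesgue_rV /pushforward preimage_set0 measure0. Qed.

Let lebesgue_rV_ge0 A : 0 <= lebesgue_rV A.
Proof. by rewrite /lebesgue_rV /pushforward measure_ge0. Qed.

Let lebesgue_rV_sigma_additive : semi_sigma_additive lebesgue_rV.
Proof.
move=> F mF tF mUF; rewrite /lebesgue_rV /pushforward preimage_bigcup.
apply: measure_semi_sigma_additive.
- by move=> k; exact: mpre.
- apply/trivIsetP => /= i j _ _ ij; rewrite -preimage_setI.
  by move/trivIsetP : tF => /(_ _ _ _ _ ij) ->//; rewrite preimage_set0.
- by rewrite -preimage_bigcup; exact: mpre.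
Qed.

HB.instance Definition _ := isMeasure.Build _ _ _ lebesgue_rV
  lebesgue_rV0 lebesgue_rV_ge0 lebesgue_rV_sigma_additive.

Let lebesgue_rV_sigma_finite : sigma_finite setT lebesgue_rV.
Proof.
have [F UF Foo] :=
  sigma_finiteT (power_measure (@lebesgue_measure R) d).
exists (fun k => tuple_of_rV @^-1` F k) => [|k].
  by rewrite -preimage_bigcup -UF preimage_setT.
have [mF Fk] := Foo k; split.
  by rewrite -[X in measurable X]setTI; exact: measurable_tuple_of_rV.
rewrite /lebesgue_rV /pushforward -comp_preimage (_ : _ \o _ = id)//.
by apply/funext => x; exact: rV_of_tupleK.
Qed.

HB.instance Definition _ := Measure_isSigmaFinite.Build _ _ _
  lebesgue_rV lebesgue_rV_sigma_finite.

Lemma lebesgue_rV_box (A : 'I_d -> set R) :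
  (forall i, measurable (A i : set (measurableTypeR R))) ->
  lebesgue_rV [set x : 'rV[R]_d | forall i, A i (x ord0 i)] =
  \prod_(i < d) lebesgue_measure (A i).
Proof.
move=> mA; rewrite -(power_measure_box (@lebesgue_measure R) mA).
congr (power_measure _ _ _); apply/seteqP; split=> t /= At i.
  by have := At i; rewrite mxE.
by rewrite mxE.
Qed.

Lemma lebesgue_rV_ball (x : 'rV[R]_d) (e : R) : (0 < e)%R ->
  lebesgue_rV (ball x e) = ((e *+ 2) ^+ d)%:E.
Proof.
move=> e0; rewrite ball_rVE// (lebesgue_rV_box (A := fun i => ball (x ord0 i) e)).
  rewrite (eq_bigr (fun=> (e *+ 2)%:E)) => [|i _].
    by rewrite -(big_morph EFin EFinM erefl) prodr_const card_ord.
  by rewrite lebesgue_measure_ball// ltW.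
by move=> i; exact: measurable_ball.
Qed.

Lemma measurable_rV_ball (x : 'rV[R]_d) (e : R) : (0 < e)%R ->
  measurable (ball x e).
Proof. by move=> e0; apply: open_measurable_rV; exact: ball_open. Qed.

Lemma compact_measurable_rV (K : set 'rV[R]_d) : compact K -> measurable K.
Proof.
move=> cK; rewrite -[K]setCK; apply: measurableC; apply: open_measurable_rV.
by apply: closed_openC; apply: compact_closed => //; exact: norm_hausdorff.
Qed.

Lemma compact_lebesgue_rV_lty (K : set 'rV[R]_d) :
  compact K -> lebesgue_rV K < +oo.
Proof.
move=> cK; have [M [Mreal KM]] := compact_bounded cK.
have M0 : (0 < `|M| + 2)%R by rewrite ltr_wpDl.
have : lebesgue_rV (ball (0%R : 'rV[R]_d) (`|M| + 2)%R) < +oo.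
  by rewrite lebesgue_rV_ball// ltry.
apply: le_lt_trans.
  apply: le_measure; rewrite ?inE.
  - exact: compact_measurable_rV.
  - exact: measurable_rV_ball.
  - move=> x Kx; rewrite -ball_normE/= sub0r normrN.
    apply: (@le_lt_trans _ _ (`|M| + 1)%R); last by rewrite ltrD2l ltr1n.
    by apply: KM => //; rewrite ltr_pwDr// ler_norm.
Qed.

Lemma interior_lebesgue_rV_gt0 (K : set 'rV[R]_d) :
  measurable K -> K° !=set0 -> 0 < lebesgue_rV K.
Proof.
move=> mK [x /nbhs_ballP[e /= e0 xeK]].
apply: (@lt_le_trans _ _ (lebesgue_rV (ball x e))).
  by rewrite lebesgue_rV_ball// lte_fin exprn_gt0// mulrn_wgt0.
by apply: le_measure; rewrite ?inE//; exact: measurable_rV_ball.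
Qed.

End lebesgue_rV.

Section density.
Local Open Scope ereal_scope.
Context (R : realType) (d : nat).

Record density := Density {
  pdf :> 'rV[R]_d -> R ;
  measurable_pdf : measurable_fun setT (pdf : 'rV[R]_d -> measurableTypeR R) ;
  pdf_ge0 : forall x, (0 <= pdf x)%R ;
  integral_pdf : \int[@lebesgue_rV R d]_x (pdf x)%:E = 1 }.

Definition density_law (f : density) : set 'rV[R]_d -> \bar R :=
  fun A => \int[@lebesgue_rV R d]_(x in A) (f x)%:E.

Section probability.
Variable f : density.

Let density_law0 : density_law f set0 = 0.
Proof. by rewrite /density_law integral_set0. Qed.

Let density_law_ge0 A : 0 <= density_law f A.
Proof. by apply: integral_ge0 => x _; rewrite lee_fin pdf_ge0. Qed.

Let density_law_sigma_additive : semi_sigma_additive (density_law f).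
Proof.
move=> /= F mF tF mUF; rewrite /density_law; apply: cvg_toP.
  apply: ereal_nondecreasing_is_cvgn => m n mn.
  apply: lee_sum_nneg_natr => // k _ _; exact: density_law_ge0.
rewrite ge0_integral_bigcup//=.
- apply: measurable_funTS; apply: measurableT_comp => //.
  exact: measurable_pdf.
- by move=> x _; rewrite lee_fin pdf_ge0.
Qed.

HB.instance Definition _ := isMeasure.Build _ _ _ (density_law f)
  density_law0 density_law_ge0 density_law_sigma_additive.

Let density_law_setT : density_law f [set: _] = 1.
Proof. exact: integral_pdf. Qed.

HB.instance Definition _ := Measure_isProbability.Build _ _ _ (density_law f)
  density_law_setT.

End probability.
End density.

Section iid_law.
Local Open Scope ereal_scope.
Context d (T : measurableType d) (R : realType).

Definition iid_law (P : set T -> \bar R) (n : nat) :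
  set (n.-tuple T) -> \bar R := power_measure P n.
Arguments iid_law P n _ : clear implicits.

Variables (P : probability T R) (n : nat).

HB.instance Definition _ := Measure.on (iid_law P n).

Let iid_law_setT : iid_law P n setT = 1.
Proof.
rewrite /iid_law (_ : setT = [set t : n.-tuple T | forall i, setT (tnth t i)]).
  by rewrite (power_measure_box P (A := fun=> setT))// big1// => i _;
    exact: (probability_setT P).
by apply/seteqP; split.
Qed.

HB.instance Definition _ := Measure_isProbability.Build _ _ _ (iid_law P n)
  iid_law_setT.

End iid_law.
Arguments iid_law {d T R} P n _.

Section convex_geometry.
Context (R : realType) (d : nat).

Definition convex_hull (A : set 'rV[R]_d) : set 'rV[R]_d :=
  smallest (@convex_set R 'rV[R]_d) A.

(* The vertices of a polytope are its extreme points. *)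
Definition vertices (C : set 'rV[R]_d) : set 'rV[R]_d :=
  [set v | C v /\ forall x y (t : R), C x -> C y -> 0 < t < 1 ->
     v = t *: x + (1 - t) *: y -> x = v /\ y = v].

Lemma convex_hull_convex (A : set 'rV[R]_d) :
  @convex_set R 'rV[R]_d (convex_hull A).
Proof.
move=> x y t; rewrite !inE => xA yA B [cB AB].
have := cB x y t; rewrite !inE; apply; [exact: xA|exact: yA].
Qed.

Lemma vertices_convex_hull (A : set 'rV[R]_d) : vertices (convex_hull A) `<=` A.
Proof.
move=> v [Av vext]; apply: contrapT => nAv.
suff : convex_hull A `<=` convex_hull A `\ v by move=> /(_ _ Av) [_]; exact.
apply: smallest_sub; last first.
  by move=> x Ax; split; [exact: sub_gen_smallest|move=> /= xv; apply: nAv; rewrite -xv].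
apply/convex_setW => x y; rewrite !inE => -[Ax xv] [Ay yv] k k0 k1.
rewrite inE; split.
  by have := @convex_hull_convex A x y k; rewrite !inE; exact.
move=> /= e; have [//|xv' _] := vext x y k%:num Ax Ay _ (esym e).
  by rewrite k0 k1.
exact: xv.
Qed.

(* [fset_set] is the empty finite set on infinite sets; this never happens
   here, by [vertices_convex_hull]. *)
Definition nb_vertices n (x : n.-tuple 'rV[R]_d) : nat :=
  #|` fset_set (vertices (convex_hull [set` x]))|.

(* The norm of the library on ['rV[R]_d] is the maximum norm. *)
Definition unit_ball : set 'rV[R]_d :=
  [set x | Num.sqrt (\sum_(i < d) x ord0 i ^+ 2) <= 1].

Record convex_body := ConvexBody {
  body :> set 'rV[R]_d ;
  compact_body : compact body ;
  convex_set_body : @convex_set R 'rV[R]_d body ;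
  interior_body : body° !=set0 }.

Definition unit_bodies : set convex_body := [set K | K `<=` unit_ball].

Definition bounded_densities (K : set 'rV[R]_d) (M : R) : set (density R d) :=
  [set f | (forall x, ~ K x -> f x = 0) /\ (forall x, f x <= M)].

End convex_geometry.

Section uniform_density.
Context (R : realType) (d : nat) (K : convex_body R d).

Definition volume : R := fine (lebesgue_rV K).

Lemma measurable_body : measurable (K : set 'rV[R]_d).
Proof. by apply: compact_measurable_rV; exact: compact_body. Qed.

Lemma volumeE : volume%:E = lebesgue_rV K.
Proof.
rewrite fineK// ge0_fin_numE ?measure_ge0//.
by apply: compact_lebesgue_rV_lty; exact: compact_body.
Qed.

Lemma volume_gt0 : 0 < volume.
Proof.
rewrite -lte_fin volumeE; apply: interior_lebesgue_rV_gt0.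
  exact: measurable_body.
exact: interior_body.
Qed.

Definition uniform_rV_pdf (x : 'rV[R]_d) : R := volume^-1 * \1_K x.

Let measurable_uniform_rV_pdf :
  measurable_fun setT (uniform_rV_pdf : 'rV[R]_d -> measurableTypeR R).
Proof.
apply: measurable_funM => //; apply: measurable_indic; exact: measurable_body.
Qed.

Let uniform_rV_pdf_ge0 x : 0 <= uniform_rV_pdf x.
Proof. by rewrite mulr_ge0// ?invr_ge0 ltW// volume_gt0. Qed.

Let integral_uniform_rV_pdf :
  (\int[@lebesgue_rV R d]_x (uniform_rV_pdf x)%:E = 1)%E.
Proof.
under eq_integral do rewrite EFinM.
rewrite ge0_integralZl//; last 2 first.
- by apply: measurableT_comp => //; apply: measurable_indic; exact: measurable_body.
- by rewrite lee_fin invr_ge0 ltW// volume_gt0.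
rewrite integral_indic//; last exact: measurable_body.
transitivity (volume^-1%:E * volume%:E)%E; first by rewrite setIT volumeE.
by rewrite -EFinM mulVf// gt_eqF// volume_gt0.
Qed.

Definition uniform_rV : density R d :=
  Density measurable_uniform_rV_pdf uniform_rV_pdf_ge0 integral_uniform_rV_pdf.

End uniform_density.

Section moments.
Local Open Scope ereal_scope.
Context (R : realType) (d : nat).

Definition moment_nb_vertices (f : density R d) (n q : nat) : \bar R :=
  'E_(iid_law (density_law f) n)[
    fun x : n.-tuple 'rV[R]_d => ((nb_vertices x)%:R ^+ q)%R].

(* Supremum of nonnegative quantities, 0 over the empty set (where the library's
   [ereal_sup] is -oo). *)
Definition nnsup (A : set (\bar R)) : \bar R :=
  if A == set0 then 0 else ereal_sup A.

End moments.
Arguments nnsup {R} A.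

(* Main.v *)
Require Import Defs.
From mathcomp Require Import all_boot all_order all_algebra finmap.
From mathcomp Require Import all_classical all_reals all_analysis.
From mathcomp Require Import measurable_realfun zify ring lra.

Set Implicit Arguments.
Unset Strict Implicit.
Unset Printing Implicit Defensive.

Import Order.TTheory GRing.Theory Num.Theory.
Import numFieldNormedType.Exports.

Local Open Scope classical_set_scope.
Local Open Scope ring_scope.

(** Both sides are compared with the power [N ^ (q (d - 1))] of a scale [N]
    satisfying [N ^ (d + 1) <= n < (N + 1) ^ (d + 1)].

    Upper bound.  Take the support normal at a vertex of a convex hull and the
    coordinate axis closest to it; this sorts the vertices into [2 d] classes.
    The vertices of one class lie on the graph of a concave function of the
    [d - 1] other coordinates whose slopes are at most 1.  Such functions have
    small metric entropy: recording their values on a grid of step [1 / N], up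
    to [1 / N ^ 2], leaves only [C ^ (N ^ (d - 1))] cases, because along each
    line of the grid the rounded values form an almost concave sequence of
    length [O(N)] with increments [O(N)] ([line_code_inj],
    [card_pattern_type]).  Two functions with the same record differ on a
    cell by at most [1 / N ^ 2] plus the second differences of one of them
    ([lip_concave_close]), and these telescope when summed over the cells
    ([sum_flatness]); the graphs of all the functions with a given record
    therefore fit into a set of volume [O(1 / N ^ 2)]
    ([lebesgue_graph_container]).  Altogether, whatever the sample, the
    vertices of its hull that lie in the cube are contained in one of at most
    [C ^ (N ^ (d - 1))] fixed sets of volume [O(1 / N ^ 2)]
    ([vertices_in_hull_container]).  Under a density bounded by [M], each of
    these sets has probability [p = O(M / N ^ 2)], and the number of sample
    points that fall in it is binomial with mean
    [n p = O(N ^ (d - 1))].  A union bound on the exponential moment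
    of the number of vertices gives
    [E [2 ^ R_n] <= 2 ^ (c N ^ (d - 1))], hence
    [E [R_n ^ q] <= U N ^ (q (d - 1))] with [U] depending only on [d], [M]
    and [q] ([moment_nb_vertices_upper]).

    Lower bound.  One body suffices: the piece
    [sum_l y_l ^ 2 <= x_0 <= 1 / 2] of a paraboloid.  It has [N ^ (d - 1)]
    disjoint caps of height of order [1 / N ^ 2] and volume of order
    [N ^ - (d + 1)], hence of probability at least of order [1 / n], so each
    of them is hit by a uniform sample with probability bounded below
    ([cap_hit_prob_ge]).  A cap that is hit contains a vertex of the hull, so
    that [E [R_n ^ q] >= c N ^ (q (d - 1))]
    ([moment_nb_vertices_lower]). *)

(** * Entropy of almost concave integer sequences *)

Section line_code.
Variables (N L B : nat).
Local Notation S := (4 * L + 2 * N + 4)%N.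

(** Rounding down a concave sequence keeps its second differences at most 1. *)
Definition nearly_concave (k : nat -> int) :=
  [/\ `|k 0%N| <= B%:Z,
      forall j, `|k j.+1 - k j| <= N.+1%:Z &
      forall j, k j + k j.+2 <= 2 * k j.+1 + 1].

(** The tilt by [2 j] makes the negated slopes strictly increasing although the
    sequence is concave only up to the rounding error; the sequence of tilted
    slopes is then determined by the set of its values, and this leaves only
    exponentially many codes. The constant [N + 1] keeps the values nonnegative. *)
Definition tilted_slope (k : nat -> int) (j : nat) : nat :=
  absz (N.+1%:Z + 2 * j%:Z - (k j.+1 - k j))%R.

Definition line_code (k : nat -> int) : 'I_(2 * B).+1 * {set 'I_S} :=
  (inord (absz (k 0%N + B%:Z)%R),
   finset (fun i : 'I_S => [exists j : 'I_L, tilted_slope k j == i])).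

Lemma tilted_slope_sorted k : nearly_concave k ->
  sorted ltn [seq tilted_slope k j | j <- iota 0 L].
Proof.
move=> [_ k1 k2]; rewrite sorted_map.
apply: (@sub_sorted _ ltn); last exact: iota_ltn_sorted.
move=> i j /= /subnK <-; elim: (j - i.+1)%N => [|n IH].
  rewrite add0n /tilted_slope; have := k1 i; have := k1 i.+1; have := k2 i; lia.
rewrite addSn; apply: (ltn_trans IH); rewrite addnS /tilted_slope.
set m := (n + i)%N; have := k1 m.+1; have := k1 m.+2; have := k2 m.+1; lia.
Qed.

Lemma tilted_slope_lt k j : nearly_concave k -> (j < L)%N ->
  (tilted_slope k j < S)%N.
Proof. move=> [_ k1 _] jL; rewrite /tilted_slope; have := k1 j; lia. Qed.

Lemma mem_tilted_slope k i : nearly_concave k ->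
  (i \in [seq tilted_slope k j | j <- iota 0 L]) =
  (if insub i is Some i' then i' \in (line_code k).2 else false).
Proof.
move=> kc; apply/mapP/idP => [[j]|].
  rewrite mem_iota add0n => /andP[_ jL] ->.
  rewrite insubT ?tilted_slope_lt// => jS.
  by rewrite inE; apply/existsP; exists (Ordinal jL).
case: insubP => // i' _ <-; rewrite inE => /existsP[j /eqP ji].
by exists (j : nat); [rewrite mem_iota add0n ltn_ord|].
Qed.

(** A strictly increasing sequence is recovered from its set of values, and the
    sequence [k] from its slopes and its first term. *)
Lemma line_code_inj k k' : nearly_concave k -> nearly_concave k' ->
  line_code k = line_code k' -> forall j, (j <= L)%N -> k j = k' j.
Proof.
move=> kc kc' kk'; have : [seq tilted_slope k j | j <- iota 0 L] =
                          [seq tilted_slope k' j | j <- iota 0 L].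
  apply: (irr_sorted_eq ltn_trans ltnn); rewrite ?tilted_slope_sorted//.
  by move=> i; rewrite !mem_tilted_slope// kk'.
move/eq_in_map => ss.
elim=> [_|j IH jL].
  move: kk'; rewrite /line_code => -[] /(congr1 val)/=.
  case: kc => kB _ _; case: kc' => kB' _ _.
  by rewrite !inordK; lia.
have := IH (ltnW jL); have : j \in iota 0 L by rewrite mem_iota.
move=> /ss; rewrite /tilted_slope.
case: kc => _ k1 _; case: kc' => _ k1' _; have := k1 j; have := k1' j; lia.
Qed.

End line_code.

Lemma line_code_close (R : realType) (N L B : nat) (a b : nat -> R) : (0 < N)%N ->
  (forall c, c = a \/ c = b -> [/\ `|c 0%N| <= B%:R,
     forall j, `|c j.+1 - c j| <= N%:R^-1 &
     forall j, c j + c j.+2 <= 2 * c j.+1]) ->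
  let k (c : nat -> R) j := Num.floor (N%:R ^+ 2 * c j) in
  line_code N L (B * N ^ 2) (k a) = line_code N L (B * N ^ 2) (k b) ->
  forall j, (j <= L)%N -> `|a j - b j| <= N%:R ^- 2.
Proof.
move=> N0 cP k kab.
have N0' : 0 < N%:R :> R by rewrite ltr0n.
have kP c j : (k c j)%:~R <= N%:R ^+ 2 * c j < (k c j)%:~R + 1.
  by rewrite /k; have := floor_itv (N%:R ^+ 2 * c j); rewrite intrD.
have kc c : c = a \/ c = b -> nearly_concave N (B * N ^ 2) (k c).
  move=> /cP[c0 c1 c2]; split.
  - have := kP c 0%N; move: c0; rewrite ler_norml => /andP[c0 c0'] /andP[h1 h2].
    have e : ((B * N ^ 2)%N%:Z)%:~R = N%:R ^+ 2 * B%:R :> R.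
      by rewrite -pmulrn natrM natrX mulrC.
    have l1 : N%:R ^+ 2 * - B%:R <= N%:R ^+ 2 * c 0%N by rewrite ler_pM2l ?exprn_gt0.
    have l2 : N%:R ^+ 2 * c 0%N <= N%:R ^+ 2 * B%:R by rewrite ler_pM2l ?exprn_gt0.
    have : (- (B * N ^ 2)%N%:Z)%:~R < (k c 0%N + 1)%:~R :> R.
      by rewrite intrD intrN e; lra.
    have : (k c 0%N)%:~R <= ((B * N ^ 2)%N%:Z)%:~R :> R by rewrite e; lra.
    rewrite ler_int ltr_int; lia.
  - move=> j; have := kP c j; have := kP c j.+1 => /andP[h1 h2] /andP[h3 h4].
    have : `|N%:R ^+ 2 * c j.+1 - N%:R ^+ 2 * c j| <= N%:R.
      rewrite -mulrBr normrM ger0_norm ?exprn_ge0 ?ler0n// expr2 -mulrA.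
      by rewrite -[leRHS]mulr1 ler_pM2l// -ler_pdivlMl// mulr1.
    rewrite ler_norml => /andP[h5 h6].
    have : (k c j.+1 - k c j)%:~R < (N.+1%:Z)%:~R :> R.
      by rewrite intrB -pmulrn -natr1; lra.
    have : (- N.+1%:Z)%:~R < (k c j.+1 - k c j)%:~R :> R.
      by rewrite intrN intrB -pmulrn -natr1; lra.
    rewrite !ltr_int; lia.
  - move=> j; have := kP c j; have := kP c j.+1; have := kP c j.+2.
    move=> /andP[h1 h2] /andP[h3 h4] /andP[h5 h6].
    have : N%:R ^+ 2 * (c j + c j.+2) <= N%:R ^+ 2 * (2 * c j.+1).
      by rewrite ler_pM2l ?exprn_gt0.
    rewrite mulrDr mulrCA => h7.
    have : (k c j + k c j.+2)%:~R < (2 * k c j.+1 + 2)%:~R :> R.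
      by rewrite !intrD intrM; lra.
    rewrite ltr_int; lia.
move=> j jL; have kj := line_code_inj (kc a (or_introl erefl))
  (kc b (or_intror erefl)) kab jL.
rewrite -[leRHS]mul1r ler_pdivlMr ?exprn_gt0//.
rewrite -[X in _ * X]ger0_norm ?exprn_ge0 ?ler0n// -normrM.
have := kP a j; have := kP b j; rewrite -kj => /andP[h1 h2] /andP[h3 h4].
by rewrite mulrC mulrBr ler_norml; apply/andP; split; lra.
Qed.

(** * Concave functions with slopes at most 1, and their second differences *)

(** Concavity and the slope bound are both expressed by supergradients with
    coordinates between [-1] and [1]: this is the form in which such functions arise
    from supporting hyperplanes. The bound at [0] is the one that holds for
    graphs through points of the cube. *)
Definition lip_concave (R : realType) (D : nat) (g : 'rV[R]_D -> R) :=
  `|g 0| <= D.+1%:R /\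
  forall y, exists u : 'rV[R]_D, (forall l, `|u 0 l| <= 1) /\
    forall y', g y' <= g y + \sum_l u 0 l * (y' 0 l - y 0 l).

Section lip_concave_lemmas.
Context (R : realType) (D : nat).
Implicit Types g : 'rV[R]_D -> R.

Lemma lip_concave_lip g y y' : lip_concave g ->
  `|g y - g y'| <= \sum_l `|y 0 l - y' 0 l|.
Proof.
move=> [_ sg].
have one a b : g a - g b <= \sum_l `|a 0 l - b 0 l|.
  have [u [u1 ub]] := sg b; rewrite lerBlDl; apply: (le_trans (ub a)).
  rewrite lerD2l; apply: ler_sum => l _.
  apply: (le_trans (ler_norm _)); rewrite normrM -[leRHS]mul1r.
  exact: ler_wpM2r.
rewrite ler_norml one andbT lerNl opprB.
by apply: (le_trans (one _ _)); apply: ler_sum => l _; rewrite distrC.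
Qed.

Lemma lip_concave_midpoint g y h : lip_concave g ->
  g (y + h) + g (y - h) <= 2 * g y.
Proof.
move=> [_ /(_ y)[u [_ ub]]]; have := lerD (ub (y + h)) (ub (y - h)).
move/le_trans; apply; rewrite addrACA -big_split/= big1 ?addr0; first by lra.
by move=> l _; rewrite !mxE; ring.
Qed.

Definition second_diff g (s : R) (p : 'rV[R]_D) (i : 'I_D) :=
  2 * g p - g (p + s *: delta_mx 0 i) - g (p - s *: delta_mx 0 i).

Lemma second_diff_ge0 g s p i : lip_concave g -> 0 <= second_diff g s p i.
Proof.
move=> gc; have := lip_concave_midpoint p (s *: delta_mx 0 i) gc.
by rewrite /second_diff; lra.
Qed.

(** The supergradient of [g] at [y] bounds [g y] from below by the barycentre of
    the values of [g] at [p] and at the points [p + s e_i]; the supergradient of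
    [g'] at [p] bounds [g' y] from above by extrapolation of the values of [g']
    at the points [p - s e_i]. The two estimates differ by second differences
    of [g'] at [p]. *)
Lemma lip_concave_close g g' (s e : R) (p y : 'rV[R]_D) :
  lip_concave g -> lip_concave g' -> 0 < s ->
  (forall l, 0 <= y 0 l - p 0 l) -> \sum_l (y 0 l - p 0 l) <= s ->
  `|g p - g' p| <= e ->
  (forall i, `|g (p + s *: delta_mx 0 i) - g' (p + s *: delta_mx 0 i)| <= e) ->
  g' y - g y <= e + \sum_i second_diff g' s p i.
Proof.
move=> gc g'c s0 t0 ts ep epi.
have [_ /(_ y)[u [_ uy]]] := gc; have [_ /(_ p)[w [_ wp]]] := g'c.
pose la i := (y 0 i - p 0 i) / s.
have la0 i : 0 <= la i by rewrite divr_ge0// ltW.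
have sla : \sum_i la i <= 1.
  by rewrite -mulr_suml ler_pdivrMr// mul1r.
have la1 i : la i <= 1.
  apply: le_trans sla; rewrite (bigD1 i)//= lerDl sumr_ge0//.
have sdelta (v q : 'rV[R]_D) r i : \sum_l v 0 l * ((q + r *: delta_mx 0 i) 0 l - p 0 l)
    = \sum_l v 0 l * (q 0 l - p 0 l) + r * v 0 i.
  rewrite (eq_bigr (fun l => v 0 l * (q 0 l - p 0 l) + v 0 l * (r * (l == i)%:R))).
    rewrite big_split/=; congr (_ + _);
      rewrite (bigD1 i)//= eqxx mulr1 big1 ?addr0 1?mulrC//.
    by move=> l /negbTE ->; rewrite mulr0 mulr0.
  by move=> l _; rewrite !mxE eqxx/=; ring.
have s0p (v : 'rV[R]_D) : \sum_l v 0 l * (p 0 l - p 0 l) = 0.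
  by rewrite big1// => l _; rewrite subrr mulr0.
pose U := \sum_l u 0 l * (y 0 l - p 0 l).
have g1 : g' p - e <= g y - U.
  have := uy p; move: ep; rewrite ler_norml => /andP[h1 h2].
  have -> : \sum_l u 0 l * (p 0 l - y 0 l) = - U.
    by rewrite -sumrN; apply: eq_bigr => l _; ring.
  by lra.
have g2 i : g' (p + s *: delta_mx 0 i) - e <= g y - U + s * u 0 i.
  have := uy (p + s *: delta_mx 0 i).
  move: (epi i); rewrite ler_norml => /andP[h1 h2].
  have -> : \sum_l u 0 l * ((p + s *: delta_mx 0 i) 0 l - y 0 l) = - U + s * u 0 i.
    have := sdelta u p s i; rewrite s0p add0r => <-.
    rewrite /U -sumrN -big_split/=.
    by apply: eq_bigr => l _; ring.
  by lra.
have g3 i : s * w 0 i <= g' p - g' (p - s *: delta_mx 0 i).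
  have := wp (p - s *: delta_mx 0 i); rewrite -scaleNr sdelta s0p add0r.
  by rewrite scaleNr; lra.
have g4 := wp y.
have sU : \sum_i la i * (s * u 0 i) = U.
  by apply: eq_bigr => i _; rewrite /la; field; rewrite gt_eqF.
have sW : \sum_l w 0 l * (y 0 l - p 0 l) = \sum_i la i * (s * w 0 i).
  by apply: eq_bigr => i _; rewrite /la; field; rewrite gt_eqF.
(* [y] is the barycentre of [p] and the [p + s e_i] with weights [la i] *)
have g5 : (1 - \sum_i la i) * (g' p - e)
    + \sum_i la i * (g' (p + s *: delta_mx 0 i) - e) <= g y.
  have h1 : (1 - \sum_i la i) * (g' p - e) <= (1 - \sum_i la i) * (g y - U).
    by rewrite ler_wpM2l// subr_ge0.
  have h2 : \sum_i la i * (g' (p + s *: delta_mx 0 i) - e) <=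
            \sum_i la i * (g y - U + s * u 0 i).
    by apply: ler_sum => i _; exact: ler_wpM2l.
  have h3 : \sum_i la i * (g y - U + s * u 0 i) = (\sum_i la i) * (g y - U) + U.
    under eq_bigr do rewrite mulrDr.
    by rewrite big_split/= -mulr_suml sU.
  by lra.
have g6 : \sum_i la i * (g' p + s * w 0 i - g' (p + s *: delta_mx 0 i))
   <= \sum_i second_diff g' s p i.
  apply: ler_sum => i _.
  apply: (@le_trans _ _ (la i * second_diff g' s p i)).
    by apply: ler_wpM2l => //; rewrite /second_diff; have := g3 i; lra.
  by rewrite -[leRHS]mul1r ler_wpM2r// second_diff_ge0.
have g7 : \sum_i la i * (g' p + s * w 0 i - g' (p + s *: delta_mx 0 i)) =
   (\sum_i la i) * (g' p - e) + \sum_i la i * (s * w 0 i)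
   - \sum_i la i * (g' (p + s *: delta_mx 0 i) - e).
  rewrite mulr_suml -big_split/= -sumrB; apply: eq_bigr => i _; ring.
move: g4; rewrite sW; lra.
Qed.

End lip_concave_lemmas.

(** * Grid patterns and their number *)

Section grid.
Context (R : realType) (D : nat).
Implicit Types g : 'rV[R]_D.+1 -> R.

(** Index [D + 1] is the coordinate [-1]: the grid leaves a margin of [D + 1]
    steps on both sides of the cube, so that second differences with step
    [(D + 1) / N] are available at all grid points of the cube. *)
Definition grid_point (N : nat) (v : 'I_D.+1 -> nat) : 'rV[R]_D.+1 :=
  \row_l ((v l)%:R / N%:R - 1 - D.+1%:R / N%:R).

Definition insert_at (i : 'I_D.+1) (j : nat) (r : 'I_D -> nat) : 'I_D.+1 -> nat :=
  fun l => oapp r j (unlift i l).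

Lemma insert_at_self i j r : insert_at i j r i = j.
Proof. by rewrite /insert_at unlift_none. Qed.

Lemma insert_at_lift i j r l : insert_at i j r (lift i l) = r l.
Proof. by rewrite /insert_at liftK. Qed.

Lemma insert_atK i v : insert_at i (v i) (fun l => v (lift i l)) = v.
Proof.
by apply/funext => l; rewrite /insert_at; case: unliftP => [k|] ->.
Qed.

Lemma grid_point_insertS N i j m r :
  grid_point N (insert_at i (j + m) r) =
  grid_point N (insert_at i j r) + (m%:R / N%:R) *: delta_mx 0 i.
Proof.
apply/rowP => l; rewrite !mxE eqxx/=; case: (unliftP i l) => [k|] ->.
  by rewrite !insert_at_lift eq_sym (negbTE (neq_lift i k)) mulr0 addr0.
by rewrite !insert_at_self eqxx natrD mulr1; ring.
Qed.

Lemma grid_point_insert1 N i j r :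
  grid_point N (insert_at i j.+1 r) =
  grid_point N (insert_at i j r) + N%:R^-1 *: delta_mx 0 i.
Proof. by have := grid_point_insertS N i j 1 r; rewrite addn1 mul1r. Qed.

Definition grid_size (N : nat) := (2 * N + 1 + 2 * D.+1)%N.

Definition value_bound : nat := (D.+2 + D.+1 * (2 * D + 5))%N.

Lemma lip_concave_grid_bound g N v : (0 < N)%N -> lip_concave g ->
  (forall l, v l <= grid_size N)%N ->
  `|g (grid_point N v)| <= value_bound%:R.
Proof.
move=> N0 gc vL; have := lip_concave_lip (grid_point N v) 0 gc.
have N1 : 1 <= N%:R :> R by rewrite ler1n.
have Np : 0 < N%:R :> R by rewrite ltr0n.
have : \sum_l `|grid_point N v 0 l - (0 : 'rV[R]_D.+1) 0 l| <= (D.+1 * (2 * D + 5))%:R.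
  rewrite natrM; apply: (@le_trans _ _ (\sum_(l < D.+1) (2 * D + 5)%:R)); last first.
    by rewrite sumr_const card_ord -[leLHS]mulr_natl.
  apply: ler_sum => l _; rewrite !mxE subr0.
  have h1 : (v l)%:R / N%:R <= (2 * D + 5)%:R :> R.
    rewrite ler_pdivrMr// -natrM ler_nat; apply: (leq_trans (vL l)).
    by rewrite /grid_size; nia.
  have h2 : 0 <= (v l)%:R / N%:R :> R by rewrite divr_ge0.
  have h3 : D.+1%:R / N%:R <= D.+1%:R :> R by rewrite ler_pdivrMr// ler_peMr.
  have h4 : 0 <= D.+1%:R / N%:R :> R by rewrite divr_ge0.
  have h5 : (2 * D + 5)%:R = 2 * D%:R + 5 :> R by rewrite natrD natrM.
  have h6 : 0 <= D%:R :> R by [].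
  move: h1 h3; rewrite h5 -natr1 => h1 h3.
  by rewrite ler_norml; apply/andP; split; lra.
have [g0 _] := gc; move: g0; rewrite /value_bound natrD !ler_norml.
by move=> /andP[? ?] ? /andP[? ?]; apply/andP; split; lra.
Qed.

(** One line code for each grid line parallel to the first axis. *)
Definition pattern_type (N : nat) : finType :=
  {ffun {ffun 'I_D -> 'I_(grid_size N).+1} ->
     'I_(2 * (value_bound * N ^ 2)).+1 * {set 'I_(4 * grid_size N + 2 * N + 4)}}.

Definition pattern N g : pattern_type N :=
  [ffun r : {ffun 'I_D -> 'I_(grid_size N).+1} =>
    line_code N (grid_size N) (value_bound * N ^ 2)
    (fun j => Num.floor (N%:R ^+ 2 *
        g (grid_point N (insert_at ord0 j (fun l => r l)))))].

Lemma pattern_close N g g' v : (0 < N)%N -> lip_concave g -> lip_concave g' ->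
  pattern N g = pattern N g' -> (forall l, v l <= grid_size N)%N ->
  `|g (grid_point N v) - g' (grid_point N v)| <= N%:R ^- 2.
Proof.
move=> N0 gc g'c gg' vL.
pose r : {ffun 'I_D -> 'I_(grid_size N).+1} := [ffun l => inord (v (lift ord0 l))].
have -> : v = insert_at ord0 (v ord0) (fun l => r l).
  rewrite -{1}[v](insert_atK ord0); congr insert_at.
  by apply/funext => l; rewrite /r ffunE inordK// ltnS vL.
move/ffunP/(_ r) : gg'; rewrite !ffunE => gg'.
apply: (@line_code_close R N (grid_size N) value_bound
  (fun j => g (grid_point N (insert_at ord0 j (fun l => r l))))
  (fun j => g' (grid_point N (insert_at ord0 j (fun l => r l)))) N0) => //.
have cP h : lip_concave h -> [/\ `|h (grid_point N (insert_at ord0 0 (fun l =>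
  r l)))| <= value_bound%:R,
     forall j, `|h (grid_point N (insert_at ord0 j.+1 (fun l =>
       r l))) - h (grid_point N (insert_at ord0 j (fun l => r l)))| <= N%:R^-1 &
     forall j, h (grid_point N (insert_at ord0 j (fun l =>
       r l))) + h (grid_point N (insert_at ord0 j.+2 (fun l =>
       r l))) <= 2 * h (grid_point N (insert_at ord0 j.+1 (fun l => r l)))].
  move=> hc; split.
  - apply: lip_concave_grid_bound => // l; rewrite /insert_at.
    by case: unliftP => //= k _; rewrite -ltnS ltn_ord.
  - move=> j; apply: (le_trans (lip_concave_lip _ _ hc)).
    rewrite (bigD1 ord0)//= big1 ?addr0.
      rewrite grid_point_insert1 [X in `|X|](_ : _ = N%:R^-1).
        by rewrite ger0_norm ?invr_ge0.
      by rewrite !mxE !eqxx/=; ring.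
    move=> l l0; rewrite grid_point_insert1 [X in `|X|](_ : _ = 0) ?normr0//.
    by rewrite !mxE (negbTE l0) andbF/= mulr0 addr0 subrr.
  - move=> j; have := @lip_concave_midpoint _ _ h
      (grid_point N (insert_at ord0 j.+1 (fun l => r l)))
      (N%:R^-1 *: delta_mx 0 ord0) hc.
    by rewrite -grid_point_insert1 addrC [in X in X - _]grid_point_insert1 addrK.
by move=> c [->|->]; exact: cP.
Qed.

(** There are [O(N ^ D)] lines, each with [C ^ N] codes; the polynomial number of
    values of the first term of a line is absorbed in [C ^ N]. *)
Lemma card_pattern_type : exists C : nat, forall N, (0 < N)%N ->
  (#|pattern_type N| <= C ^ (N ^ D.+1))%N.
Proof.
pose V := value_bound; pose A := (2 * D + 6)%N.
exists (((2 * V + 1) * 4 * 2 ^ (4 * A + 6)) ^ (A ^ D))%N => N N0.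
rewrite card_ffun card_prod card_ffun !card_ord -cardsT -powersetT card_powerset
  cardsT card_ord.
have LA : ((grid_size N).+1 <= A * N)%N by rewrite /grid_size /A; nia.
have N4 : (N ^ 2 <= 4 ^ N)%N.
  have -> : (4 = 2 ^ 2)%N by [].
  by rewrite -expnM mulnC expnM leq_exp2r// ltnW// ltn_expl.
have h1 : ((2 * (V * N ^ 2)).+1 <= ((2 * V + 1) * 4) ^ N)%N.
  rewrite expnMn; apply: (@leq_trans ((2 * V + 1) * 4 ^ N)).
    have : (0 < N ^ 2)%N by rewrite expn_gt0 N0.
    by nia.
  rewrite leq_mul2r; apply/orP; right.
  by rewrite -{1}[(2 * V + 1)%N]expn1 leq_pexp2l// addn1.
have h2 : (2 ^ (4 * grid_size N + 2 * N + 4) <= (2 ^ (4 * A + 6)) ^ N)%N.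
  by rewrite -expnM leq_pexp2l//; nia.
apply: (@leq_trans ((((2 * V + 1) * 4 * 2 ^ (4 * A + 6)) ^ N) ^ ((A * N) ^ D))%N).
  apply: (@leq_trans ((((2 * V + 1) * 4 * 2 ^ (4 * A + 6)) ^ N) ^ ((grid_size
    N).+1 ^ D))%N).
    have [->|D0] := posnP ((grid_size N).+1 ^ D)%N; first by [].
    by rewrite leq_exp2r// expnMn leq_mul.
  rewrite leq_pexp2l//; last by case: (D) => // D1; rewrite leq_exp2r.
  by rewrite expn_gt0 !muln_gt0 addn1 expn_gt0.
by rewrite -!expnM [((A * N) ^ D)%N]expnMn expnS mulnCA.
Qed.

End grid.

(** * Graphs with a given pattern lie in a set of small volume *)

Lemma measure_bigsetU_le d (T : measurableType d) (R : realType)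
    (mu : {measure set T -> \bar R}) (I : Type) (r : seq I) (F : I -> set T) :
  (forall i, measurable (F i)) ->
  (mu (\big[setU/set0]_(i <- r) F i) <= \sum_(i <- r) mu (F i))%E.
Proof.
move=> mF; elim: r => [|i r IH]; first by rewrite !big_nil measure0.
rewrite !big_cons; apply: (le_trans (measureU2 _ _ _)) => //.
- exact: bigsetU_measurable.
- exact: leeD2l.
Qed.

Lemma sum_insert_at (R : realType) (D L : nat) (i : 'I_D.+1)
    (F : ('I_D.+1 -> nat) -> R) :
  \sum_(v : {ffun 'I_D.+1 -> 'I_L}) F (fun l => v l) =
  \sum_(r : {ffun 'I_D -> 'I_L}) \sum_(j < L) F (insert_at i j (fun l => r l)).
Proof.
pose h (p : {ffun 'I_D -> 'I_L} * 'I_L) : {ffun 'I_D.+1 -> 'I_L} :=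
  [ffun l => oapp p.1 p.2 (unlift i l)].
pose h' (v : {ffun 'I_D.+1 -> 'I_L}) : {ffun 'I_D -> 'I_L} * 'I_L :=
  ([ffun l => v (lift i l)], v i).
rewrite pair_big/= (reindex h)/=.
  apply: eq_bigr => -[r j] _ /=; congr F; apply/funext => l.
  by rewrite /h ffunE /insert_at; case: (unlift i l).
exists h' => [[r j] _|v _]; rewrite /h /h'.
  congr pair => /=; last by rewrite ffunE unlift_none.
  by apply/ffunP => l; rewrite !ffunE liftK.
by apply/ffunP => l; rewrite !ffunE; case: unliftP => [k|] ->//=; rewrite ffunE.
Qed.

Lemma telescope_step (R : realType) (m L : nat) (h : nat -> R) :
  \sum_(j < L) (h j - h (j + m)%N) = \sum_(j < m) h j - \sum_(j < m) h (L + j)%N.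
Proof.
elim: L => [|L IH]; first by rewrite big_ord0 subrr.
rewrite big_ord_recr/= IH.
have : \sum_(j < m.+1) h (L + j)%N = \sum_(j < m.+1) h (L + j)%N by [].
rewrite {1}big_ord_recl big_ord_recr/= addn0.
under eq_bigr do rewrite /bump/= add1n addnS -addSn.
lra.
Qed.

Section container.
Context (R : realType) (D : nat).
Implicit Types g : 'rV[R]_D.+1 -> R.

Local Notation width N := (D.+1%:R / N%:R).

Definition shift_index (v : 'I_D.+1 -> nat) : 'I_D.+1 -> nat :=
  fun l => (v l + D.+1)%N.

(** The step [(D + 1) / N] is such that the simplex spanned by [p] and the
    points [p + s e_i] contains the cube of side [1 / N] with corner [p]. *)
Definition flatness g N (v : 'I_D.+1 -> nat) :=
  \sum_i second_diff g (width N) (grid_point R N (shift_index v)) i.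

Lemma grid_point_shift_insert N i j r :
  grid_point R N (shift_index (insert_at i j r)) =
  grid_point R N (insert_at i (j + D.+1) (fun l => r l + D.+1)%N).
Proof.
by congr grid_point; apply/funext => l; rewrite /shift_index /insert_at; case: unlift.
Qed.

Lemma grid_point_shiftN N v i :
  grid_point R N (shift_index v) - width N *: delta_mx 0 i =
  grid_point R N (insert_at i (v i) (fun l => v (lift i l) + D.+1)%N).
Proof.
by rewrite -{1}[v](insert_atK i) grid_point_shift_insert grid_point_insertS addrK.
Qed.

Lemma grid_point_shiftD N v i :
  grid_point R N (shift_index v) + width N *: delta_mx 0 i =
  grid_point R N (insert_at i (v i + D.+1 + D.+1) (fun l => v (lift i l) + D.+1)%N).
Proof.
by rewrite -{1}[v](insert_atK i) grid_point_shift_insert -grid_point_insertS.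
Qed.

Lemma sum_second_diff_line g N L i r : (0 < N)%N -> lip_concave g ->
  \sum_(j < L) second_diff g (width N)
     (grid_point R N (shift_index (insert_at i j r))) i <= D.+1%:R * (2 * width N).
Proof.
move=> N0 gc; pose a j := g (grid_point R N (insert_at i j (fun l => r l + D.+1)%N)).
have Nge0 : 0 <= width N :> R by rewrite divr_ge0.
have la j : `|a (j + D.+1)%N - a j| <= width N.
  apply: (le_trans (lip_concave_lip _ _ gc)).
  rewrite grid_point_insertS (bigD1 i)//= big1 ?addr0.
    rewrite [X in `|X|](_ : _ = width N) ?ger0_norm//.
    by rewrite !mxE !eqxx/=; ring.
  move=> l l0; rewrite [X in `|X|](_ : _ = 0) ?normr0//.
  by rewrite !mxE (negbTE l0) andbF/= mulr0 addr0 subrr.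
pose h j := a (j + D.+1)%N - a j.
rewrite (eq_bigr (fun j : 'I_L => h j - h (j + D.+1)%N)); last first.
  move=> j _; rewrite /second_diff grid_point_shiftN grid_point_shiftD.
  rewrite grid_point_shift_insert insert_at_self.
  have -> : (fun l => insert_at i j r (lift i l) + D.+1)%N = (fun l => r l + D.+1)%N.
    by apply/funext => l; rewrite insert_at_lift.
  by rewrite /h /a; ring.
rewrite telescope_step -sumrB.
apply: (@le_trans _ _ (\sum_(j < D.+1) (2 * width N))); last first.
  by rewrite sumr_const card_ord -[leLHS]mulr_natl.
apply: ler_sum => j _; move: (la j) (la (L + j)%N); rewrite -/(h _) -/(h _) !ler_norml.
by move=> /andP[? ?] /andP[? ?]; lra.
Qed.

(** On each grid line the second differences telescope into boundary terms, and
    these are bounded because the slopes are. *)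
Lemma sum_flatness g N : (0 < N)%N -> lip_concave g ->
  \sum_(v : {ffun 'I_D.+1 -> 'I_(2 * N).+1}) flatness g N (fun l => v l) <=
  ((2 * N).+1 ^ D)%:R * (D.+1%:R * (D.+1%:R * (2 * width N))).
Proof.
move=> N0 gc; rewrite /flatness exchange_big/=.
apply: (@le_trans _ _ (\sum_(i < D.+1) ((2 * N).+1 ^ D)%:R * (D.+1%:R * (2 *
  width N)))).
  apply: ler_sum => i _.
  rewrite (sum_insert_at _ i (fun v =>
    second_diff g (width N) (grid_point R N (shift_index v)) i)).
  apply: (@le_trans _ _ (\sum_(r : {ffun 'I_D ->
    'I_(2 * N).+1}) (D.+1%:R * (2 * width N)))).
    by apply: ler_sum => r _; exact: sum_second_diff_line.
  by rewrite sumr_const card_ffun !card_ord -[leLHS]mulr_natl.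
by rewrite sumr_const card_ord -[leLHS]mulr_natl mulrCA.
Qed.

Lemma flatness_ge0 g N v : lip_concave g -> 0 <= flatness g N v.
Proof. by move=> gc; apply: sumr_ge0 => i _; exact: second_diff_ge0. Qed.

(** In the other direction [lip_concave_close] brings in the second differences
    of [g]; these are compared with those of [g'] since all the points involved
    belong to the grid. *)
Lemma pattern_cell_close g g' N v (y : 'rV[R]_D.+1) : (0 < N)%N ->
  lip_concave g -> lip_concave g' -> pattern N g = pattern N g' ->
  (forall l, v l <= 2 * N)%N ->
  (forall l, 0 <= y 0 l - grid_point R N (shift_index v) 0 l <= N%:R^-1) ->
  `|g y - g' y| <= (4 * D.+1 + 1)%:R * N%:R ^- 2 + flatness g' N v.
Proof.
move=> N0 gc g'c gg' vN yv.
set p := grid_point R N (shift_index v).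
have Np : 0 < N%:R :> R by rewrite ltr0n.
have e0 : 0 <= N%:R ^- 2 :> R by rewrite invr_ge0 exprn_ge0.
have pc w : (forall l, w l <= 2 * N + 2 * D.+1)%N ->
    `|g (grid_point R N w) - g' (grid_point R N w)| <= N%:R ^- 2.
  move=> wN; apply: pattern_close => // l; apply: (leq_trans (wN l)).
  by rewrite /grid_size; lia.
have c0 : `|g p - g' p| <= N%:R ^- 2.
  by apply: pc => l; rewrite /shift_index; have := vN l; lia.
have cD i : `|g (p + width N *: delta_mx 0 i) - g' (p + width N *:
  delta_mx 0 i)| <= N%:R ^- 2.
  rewrite grid_point_shiftD; apply: pc => l; rewrite /insert_at;
    case: unliftP => [k|] _ /=.
    by have := vN (lift i k); lia.
  by have := vN i; lia.
have cN i : `|g (p - width N *: delta_mx 0 i) - g' (p - width N *: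
  delta_mx 0 i)| <= N%:R ^- 2.
  rewrite grid_point_shiftN; apply: pc => l; rewrite /insert_at;
    case: unliftP => [k|] _ /=.
    by have := vN (lift i k); lia.
  by have := vN i; lia.
have s0 : 0 < width N :> R by rewrite divr_gt0.
have yp0 l : 0 <= y 0 l - p 0 l by have /andP[] := yv l.
have yps : \sum_l (y 0 l - p 0 l) <= width N.
  apply: (@le_trans _ _ (\sum_(l < D.+1) N%:R^-1)).
    by apply: ler_sum => l _; have /andP[] := yv l.
  by rewrite sumr_const card_ord -[leLHS]mulr_natl.
have h1 := lip_concave_close g'c gc s0 yp0 yps.
have h2 := lip_concave_close gc g'c s0 yp0 yps c0 cD.
have {}h1 : g y - g' y <= N%:R ^- 2 + \sum_i second_diff g (width N) p i.
  by apply: h1 => [|i]; rewrite distrC.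
have h3 : \sum_i second_diff g (width N) p i <=
    (4 * D.+1)%:R * N%:R ^- 2 + flatness g' N v.
  have -> : (4 * D.+1)%:R * N%:R ^- 2 = \sum_(i < D.+1) 4 * N%:R ^- 2 :> R.
    by rewrite sumr_const card_ord -[RHS]mulr_natl natrM; ring.
  rewrite -big_split/=; apply: ler_sum => i _.
  rewrite /second_diff -/p; move: c0 (cD i) (cN i); rewrite !ler_norml.
  by move=> /andP[? ?] /andP[? ?] /andP[? ?]; lra.
have h4 : 0 <= (4 * D.+1)%:R * N%:R ^- 2 :> R by rewrite mulr_ge0.
have h5 : flatness g' N v = \sum_i second_diff g' (width N) p i by [].
by rewrite natrD mulrDl mul1r ler_norml; apply/andP; split; lra.
Qed.

(** [k] is the vertical coordinate. *)
Definition column_side (k : 'I_D.+2) (c : 'rV[R]_D.+1) (e t H : R) (i :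
  'I_D.+2) : set R :=
  if unlift k i is Some l then `[c 0 l, c 0 l + e]%classic
  else `[t - H, t + H]%classic.

Definition column_box (k : 'I_D.+2) (c : 'rV[R]_D.+1) (e t H : R) : set 'rV[R]_D.+2 :=
  [set x | forall i, column_side k c e t H i (x ord0 i)].

Lemma measurable_column_side (k : 'I_D.+2) (c : 'rV[R]_D.+1) (e t H : R) (i : 'I_D.+2) :
  measurable (column_side k c e t H i : set (measurableTypeR R)).
Proof. by rewrite /column_side; case: unlift => [l|]; exact: measurable_itv. Qed.

Lemma measurable_column_box k c e t H : measurable (column_box k c e t H).
Proof. exact: measurable_rV_box (measurable_column_side k c e t H). Qed.

Lemma lebesgue_column_box k c e t H : 0 <= e -> 0 <= H ->
  lebesgue_rV (column_box k c e t H) = (2 * H * e ^+ D.+1)%:E.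
Proof.
move=> e0 H0; rewrite /column_box (lebesgue_rV_box (measurable_column_side k c e t H)).
rewrite (bigD1_ord k)//= {1}/column_side unlift_none lebesgue_measure_itv/= lte_fin.
rewrite (eq_bigr (fun=> e%:E)) => [|l _]; last first.
  rewrite /column_side liftK lebesgue_measure_itv/= lte_fin ltrDl.
  case: ltP => [_|e0']; last by congr EFin; lra.
  by rewrite -EFinD; congr EFin; ring.
rewrite -(big_morph EFin EFinM erefl) prodr_const card_ord.
case: ltP => [_|H0'].
  by rewrite -EFinD -EFinM; congr EFin; ring.
by rewrite -EFinM (_ : H = 0) ?mulr0 ?mul0r//; lra.
Qed.

Definition subcell_corner N (v u : 'I_D.+1 -> nat) : 'rV[R]_D.+1 :=
  \row_l (grid_point R N (shift_index v) 0 l + (u l)%:R / N%:R ^+ 2).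

(** Of the constant [5 D + 6], the part [4 (D + 1) + 1] comes from
    [pattern_cell_close] and [D + 1] is the variation of a function with
    slopes at most 1 on a subcell of side [1 / N ^ 2]. *)
Definition half_height g N v := flatness g N v + (5 * D + 6)%:R * N%:R ^- 2.

Definition cell_index N : finType :=
  ({ffun 'I_D.+1 -> 'I_(2 * N).+1} * {ffun 'I_D.+1 -> 'I_N})%type.

Definition cell_box N (b : bool) (k : 'I_D.+2) g (p : cell_index N) :=
  let c := subcell_corner N (fun l => p.1 l) (fun l => p.2 l) in
  column_box k c (N%:R ^- 2) ((-1) ^+ b * g c) (half_height g N (fun l => p.1 l)).

(** On a cell of side [1 / N] the graph is not covered by a single box of
    height [O(1 / N ^ 2)], hence the subdivision into subcells of side
    [1 / N ^ 2], on which the slope is harmless. *)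
Definition graph_container N b k g : set 'rV[R]_D.+2 :=
  \big[setU/set0]_(p : cell_index N) cell_box b k g p.

Lemma measurable_graph_container N b k g : measurable (graph_container N b k g).
Proof. by apply: bigsetU_measurable => p _; exact: measurable_column_box. Qed.

Definition graph_volume_const : nat :=
  (4 * D.+1 ^ 3 * 3 ^ D + 2 * (5 * D + 6) * 3 ^ D.+1)%N.

Lemma lebesgue_graph_container N b k g : (0 < N)%N -> lip_concave g ->
  (lebesgue_rV (graph_container N b k g) <=
     (graph_volume_const%:R * N%:R ^- 2)%:E)%E.
Proof.
move=> N0 gc; apply: (le_trans (measure_bigsetU_le _ _ _)).
  by move=> p; exact: measurable_column_box.
have Np : 0 < N%:R :> R by rewrite ltr0n.
have e0 : 0 <= N%:R ^- 2 :> R by rewrite invr_ge0 exprn_ge0.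
have hh v : 0 <= half_height g N v.
  by rewrite /half_height addr_ge0 ?flatness_ge0// mulr_ge0.
rewrite (eq_bigr (fun p : cell_index N =>
    (2 * half_height g N (fun l => p.1 l) * N%:R ^- 2 ^+ D.+1)%:E)); last first.
  by move=> p _; rewrite /cell_box/= lebesgue_column_box.
rewrite sumEFin lee_fin.
rewrite -(pair_big xpredT xpredT (fun (v : {ffun 'I_D.+1 -> 'I_(2 * N).+1})
  (u : {ffun 'I_D.+1 -> 'I_N}) => 2 * half_height g N (fun l =>
    v l) * N%:R ^- 2 ^+ D.+1))/=.
under eq_bigr do rewrite sumr_const card_ffun !card_ord.
rewrite sumrMnl -mulr_suml -mulr_sumr /half_height big_split/= sumr_const
  card_ffun !card_ord.
have h1 := sum_flatness N0 gc.
have L3 : (2 * N).+1%:R <= 3 * N%:R :> R.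
  by rewrite -natrM ler_nat; lia.
have L3D m : ((2 * N).+1 ^ m)%:R <= 3 ^+ m * N%:R ^+ m :> R.
  by rewrite natrX -exprMn lerXn2r// nnegrE ?mulr_ge0.
have Nu : N%:R != 0 :> R by rewrite gt_eqF.
set S := \sum_(v : _) _ in h1 *.
have h2 : S <= 3 ^+ D * N%:R ^+ D * (2 * D.+1%:R ^+ 3 / N%:R).
  apply: (le_trans h1); rewrite [X in _ * X](_ : _ = 2 * D.+1%:R ^+ 3 / N%:R);
    last by ring.
  by rewrite ler_wpM2r// divr_ge0// mulr_ge0// exprn_ge0.
have h3 : ((5 * D + 6)%:R * N%:R ^- 2) *+ ((2 * N).+1 ^ D.+1) <=
    (3 ^+ D.+1 * N%:R ^+ D.+1) * ((5 * D + 6)%:R * N%:R ^- 2) :> R.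
  by rewrite -[leLHS]mulr_natl ler_wpM2r// mulr_ge0.
have h4 : 0 <= N%:R ^- 2 ^+ D.+1 * N%:R ^+ D.+1 :> R by rewrite mulr_ge0 ?exprn_ge0.
rewrite -[leLHS]mulr_natr natrX -mulrA.
apply: (@le_trans _ _ (2 * (3 ^+ D * N%:R ^+ D * (2 * D.+1%:R ^+ 3 / N%:R) +
   (3 ^+ D.+1 * N%:R ^+ D.+1) * ((5 * D + 6)%:R * N%:R ^- 2)) * (N%:R ^- 2 ^+
     D.+1 * N%:R ^+ D.+1))).
  by rewrite ler_wpM2r// ler_wpM2l// lerD.
have -> : N%:R ^- 2 ^+ D.+1 * N%:R ^+ D.+1 = (N%:R ^+ D.+1)^-1 :> R.
  by rewrite exprVn -exprM mulnC exprM expr2 invfM -mulrA mulVf ?mulr1// expf_neq0.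
rewrite le_eqVlt; apply/orP; left; apply/eqP.
rewrite /graph_volume_const !(natrX, natrD, natrM) [N%:R ^+ D.+1]exprS.
by field; rewrite Nu expf_neq0.
Qed.

Lemma graph_container_cover N (b : bool) k g g' (x : 'rV[R]_D.+2) : (0 < N)%N ->
  lip_concave g -> lip_concave g' -> pattern N g = pattern N g' ->
  (forall i, `|x 0 i| <= 1) -> x 0 k = (-1) ^+ b * g (col' k x) ->
  graph_container N b k g' x.
Proof.
move=> N0 gc g'c gg' x1 xk.
have Np : 0 < N%:R :> R by rewrite ltr0n.
have Nu : N%:R != 0 :> R by rewrite gt_eqF.
have N2 : 0 < N%:R ^+ 2 :> R by rewrite exprn_gt0.
set y := col' k x.
have y1 l : - 1 <= y 0 l <= 1 by rewrite -ler_norml mxE.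
pose z l := (y 0 l + 1) * N%:R ^+ 2.
have z0 l : 0 <= z l by apply: mulr_ge0; [have /andP[] := y1 l; lra|exact: ltW].
(* quotient and remainder of [w l] by [N] index the cell and the subcell of [y] *)
pose w l := Num.truncn (z l).
have wz l : (w l)%:R <= z l < (w l)%:R + 1.
  by rewrite /w natr1; have /andP[-> ->] := truncn_itv (z0 l).
have w2 l : (w l <= 2 * N ^ 2)%N.
  rewrite -(ler_nat R); have /andP[h _] := wz l; apply: (le_trans h).
  rewrite /z natrM natrX ler_wpM2r ?(ltW N2)//.
  by have /andP[] := y1 l; lra.
have v2 l : (w l %/ N < (2 * N).+1)%N.
  rewrite ltnS -[leqRHS](@mulnK _ N)//; apply: leq_div2r.
  by apply: (leq_trans (w2 l)); rewrite -mulnA mulnn.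
pose v : {ffun 'I_D.+1 -> 'I_(2 * N).+1} := [ffun l => Ordinal (v2 l)].
pose u : {ffun 'I_D.+1 -> 'I_N} := [ffun l => Ordinal (ltn_pmod (w l) N0)].
pose c := subcell_corner N (fun l => v l) (fun l => u l).
have cE l : c 0 l = (w l)%:R / N%:R ^+ 2 - 1.
  rewrite !mxE /v /u /shift_index !ffunE/= {3}(divn_eq (w l) N) !natrD natrM.
  by field.
have pE l : c 0 l = grid_point R N (shift_index (fun l =>
  v l)) 0 l + (u l)%:R / N%:R ^+ 2.
  by rewrite mxE.
have yc l : c 0 l <= y 0 l <= c 0 l + N%:R ^- 2.
  rewrite cE; have /andP[h1 h2] := wz l.
  have e1 : y 0 l = z l / N%:R ^+ 2 - 1 by rewrite /z; field.
  have h3 : (w l)%:R / N%:R ^+ 2 <= z l / N%:R ^+ 2 by rewrite ler_pM2r ?invr_gt0.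
  have h4 : z l / N%:R ^+ 2 <= ((w l)%:R + 1) / N%:R ^+ 2.
    by rewrite ler_pM2r ?invr_gt0// ltW.
  by rewrite e1; apply/andP; split; lra.
have cp l : 0 <= c 0 l - grid_point R N (shift_index (fun l => v l)) 0 l <= N%:R^-1.
  rewrite pE addrC addKr divr_ge0//= ler_pdivrMr// expr2 mulKf//.
  by rewrite ler_nat ltnW.
have vN l : (v l <= 2 * N)%N by rewrite -ltnS ltn_ord.
have close := pattern_cell_close N0 gc g'c gg' vN cp.
have lip : `|g y - g c| <= D.+1%:R * N%:R ^- 2.
  apply: (le_trans (lip_concave_lip _ _ gc)).
  apply: (@le_trans _ _ (\sum_(l < D.+1) N%:R ^- 2)); last first.
    by rewrite sumr_const card_ord -[leLHS]mulr_natl.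
  apply: ler_sum => l _; have /andP[? ?] := yc l.
  by rewrite ger0_norm; [lra|lra].
rewrite /graph_container -bigcup_seq/=; exists (v, u); first exact: mem_index_enum.
rewrite /cell_box/= -/c => i; rewrite /column_side; case: unliftP => [l|] ->.
  by rewrite /= in_itv/=; have := yc l; rewrite [y 0 l]mxE.
rewrite /= in_itv/= xk /half_height.
have hd : `|g y - g' c| <= flatness g' N (fun l => v l) + (5 * D + 6)%:R * N%:R ^- 2.
  have -> : (5 * D + 6)%:R = D.+1%:R + (4 * D.+1 + 1)%:R :> R.
    by rewrite -natrD; congr (_%:R); lia.
  rewrite mulrDl (_ : g y - g' c = (g y - g c) + (g c - g' c)); last by ring.
  by apply: (le_trans (ler_normD _ _)); lra.
move: hd; rewrite ler_norml => /andP[h1 h2].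
by case: (b); rewrite ?expr1 ?expr0 ?mulN1r ?mul1r; apply/andP; split; lra.
Qed.

End container.

(** * Convex combinations and support functionals *)

Section convex_combinations.
Context (R : realType) (d : nat).
Implicit Types S : set 'rV[R]_d.

Lemma convex_set_comb S (a b : 'rV[R]_d) (t : R) :
  @convex_set R 'rV[R]_d S -> S a -> S b -> 0 <= t <= 1 ->
  S (t *: a + (1 - t) *: b).
Proof.
move=> cS Sa Sb /andP[t0 t1].
by have := cS a b (Itv01 t0 t1); rewrite !inE; apply.
Qed.

Lemma convex_set01 S :
  (forall (a b : 'rV[R]_d) (t : R), S a -> S b -> 0 < t < 1 ->
     S (t *: a + (1 - t) *: b)) -> @convex_set R 'rV[R]_d S.
Proof.
move=> cS; apply/convex_setW => a b; rewrite !inE => Sa Sb k k0 k1.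
by rewrite inE; have := cS a b k%:num Sa Sb; rewrite k0 k1; apply.
Qed.

Lemma convex_set_sum S n (x : 'I_n -> 'rV[R]_d) (w : 'I_n -> R) :
  @convex_set R 'rV[R]_d S -> (forall i, w i != 0 -> S (x i)) ->
  (forall i, 0 <= w i) -> \sum_i w i = 1 -> S (\sum_i w i *: x i).
Proof.
move=> cS; elim: n x w => [|n IH] x w Sx w0 w1.
  by move: w1; rewrite big_ord0 => /eqP; rewrite eq_sym oner_eq0.
rewrite big_ord_recl; move: w1; rewrite big_ord_recl => w1.
set s := \sum_(i < n) w (lift ord0 i) in w1.
have s0 : 0 <= s by exact: sumr_ge0.
have [sz|sn] := eqVneq s 0.
  have wz i : w (lift ord0 i) = 0.
    by apply/eqP; move/eqP: sz; rewrite psumr_eq0// => /allP/(_ i);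
      rewrite mem_index_enum; exact.
  rewrite big1 => [|i _]; last by rewrite wz scale0r.
  have w01 : w ord0 = 1 by rewrite -w1 sz addr0.
  by rewrite w01 scale1r addr0; apply: Sx; rewrite w01 oner_eq0.
have e : 1 - w ord0 = s by rewrite -w1 addrC addKr.
have -> : \sum_(i < n) w (lift ord0 i) *: x (lift ord0 i) =
    (1 - w ord0) *: \sum_(i < n) (w (lift ord0 i) / s) *: x (lift ord0 i).
  rewrite e scaler_sumr; apply: eq_bigr => i _.
  by rewrite scalerA mulrCA divff// mulr1.
have S' : S (\sum_(i < n) (w (lift ord0 i) / s) *: x (lift ord0 i)).
  apply: (IH (fun i => x (lift ord0 i)) (fun i => w (lift ord0 i) / s)).
  - by move=> i ws; apply: Sx; apply: contraNN ws => /eqP ->; rewrite mul0r.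
  - by move=> i; rewrite divr_ge0.
  - by rewrite -mulr_suml divff.
have [wz|wn] := eqVneq (w ord0) 0.
  by rewrite wz scale0r add0r subr0 scale1r.
by apply: convex_set_comb => //; [exact: Sx|rewrite w0 -subr_ge0 e].
Qed.

End convex_combinations.

Lemma sum_continuous (T : topologicalType) (R : realType) (I : Type) (r : seq I)
    (F : I -> T -> R) : (forall i, continuous (F i)) ->
  continuous (fun x => \sum_(i <- r) F i x).
Proof.
move=> cF; elim: r => [|i r IH].
  under eq_fun do rewrite big_nil.
  by move=> x; exact: cvg_cst.
under eq_fun do rewrite big_cons.
by move=> x; apply: continuousD; [exact: cF|exact: IH].
Qed.

Section support.
Context (R : realType) (d : nat).

Definition dotp (u v : 'rV[R]_d) := \sum_l u 0 l * v 0 l.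

Lemma dotpDr u v w : dotp u (v + w) = dotp u v + dotp u w.
Proof. by rewrite -big_split/=; apply: eq_bigr => l _; rewrite !mxE mulrDr. Qed.

Lemma dotpZr u v a : dotp u (a *: v) = a * dotp u v.
Proof. by rewrite mulr_sumr; apply: eq_bigr => l _; rewrite !mxE; ring. Qed.

Lemma dotpBr u v w : dotp u (v - w) = dotp u v - dotp u w.
Proof. by rewrite dotpDr -scaleN1r dotpZr mulN1r. Qed.

Lemma dotpC u v : dotp u v = dotp v u.
Proof. by apply: eq_bigr => l _; rewrite mulrC. Qed.

Lemma dotp_add_scale u z a :
  dotp (u + a *: z) (u + a *: z) = dotp u u + 2 * a * dotp u z + a ^+ 2 * dotp z z.
Proof.
rewrite dotpDr dotpZr ![dotp (u + a *: z) _]dotpC !dotpDr !dotpZr [dotp z u]dotpC.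
by ring.
Qed.

Lemma dotp_ge0 u : 0 <= dotp u u.
Proof. by apply: sumr_ge0 => l _; exact: sqr_ge0. Qed.

Lemma dotp_eq0 u : dotp u u = 0 -> u = 0.
Proof.
move/eqP; rewrite psumr_eq0 => [|l _]; last exact: sqr_ge0.
move/allP => h; apply/rowP => l; rewrite mxE; apply/eqP.
by have := h l (mem_index_enum _); rewrite mulf_eq0 orbb.
Qed.

Lemma convex_hull_remove_vertex (A : set 'rV[R]_d) v : vertices (convex_hull A) v ->
  @convex_set R 'rV[R]_d (convex_hull A `\ v).
Proof.
move=> [_ vext]; apply: convex_set01 => a b t [Aa av] [Ab bv] t01; split.
  apply: convex_set_comb => //; first exact: convex_hull_convex.
  by case/andP: t01 => /ltW -> /ltW ->.
by move=> /esym/(vext _ _ _ Aa Ab t01)[].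
Qed.

(** The support functional is [v - p], where [p] is the point closest to [v]
    among the convex combinations of the sample points other than [v]; it is
    nonzero because the hull minus an extreme point is still convex. *)
Lemma vertex_support n (x : n.-tuple 'rV[R]_d) v : (0 < d)%N ->
  vertices (convex_hull [set` x]) v ->
  exists2 u, u != 0 & forall j, dotp u (tnth x j) <= dotp u v.
Proof.
move=> d0 Vv; pose y (w : 'rV[R]_n) := \sum_i w 0 i *: tnth x i.
pose A : set 'rV[R]_n := [set w | [/\ forall i, 0 <= w 0 i, \sum_i w 0 i = 1 &
   forall i, tnth x i = v -> w 0 i = 0]].
have [[j0 j0v]|allv] := pselect (exists j, tnth x j <> v); last first.
  exists (const_mx 1).
    apply/eqP => /matrixP/(_ 0 (Ordinal d0)); rewrite !mxE => /eqP.
    by rewrite oner_eq0.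
  move=> j; have [->//|xv] := pselect (tnth x j = v).
  by exfalso; apply: allv; exists j.
have deltaA j : tnth x j <> v -> A (delta_mx 0 j).
  move=> jv; split.
  - by move=> i; rewrite mxE eqxx/= ler0n.
  - rewrite (bigD1 j)//= mxE !eqxx/= big1 ?addr0// => i /negbTE ij.
    by rewrite mxE ij andbF.
  - move=> i iv; rewrite mxE eqxx/=; case: eqP => // ij.
    by exfalso; apply: jv; rewrite -ij.
have A0 : A !=set0 by exists (delta_mx 0 j0); exact: deltaA.
have cA : compact A.
  apply: bounded_closed_compact.
    exists 1; split => // M M1 w [w0 w1 _].
    rewrite /Num.norm/= mx_normrE; apply: bigmax_le => [|[i j] _/=].
      by rewrite (le_trans _ (ltW M1)).
    rewrite ord1 ger0_norm// (le_trans _ (ltW M1))// -w1 (bigD1 j)//= lerDl.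
    by apply: sumr_ge0 => k _.
  have -> : A = \bigcap_i [set w | 0 <= w 0 i] `&`
     [set w | \sum_i w 0 i = 1] `&`
     \bigcap_(i in [set i | tnth x i = v]) [set w | w 0 i = 0].
    apply/seteqP; split => [w [w0 w1 wv]|w [[w0 w1] wv]].
      by split; [split => [i _|]; [exact: w0|]|move=> i; exact: wv].
    by split=> [i||i]; [exact: w0| |exact: wv].
  have c1 : closed (\bigcap_i [set w : 'rV[R]_n | 0 <= w 0 i]).
    apply: closed_bigI => i _.
    apply: (@preimage_closed _ _ (fun w : 'rV[R]_n => w 0 i) [set t | 0 <= t]).
      by move=> w _; exact: coord_continuous.
    exact: closed_ge.
  have c2 : closed [set w : 'rV[R]_n | \sum_i w 0 i = 1].
    apply: (@preimage_closed _ _ (fun w : 'rV[R]_n => \sum_i w 0 i) [set t | t = 1]).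
      by move=> w _; apply: sum_continuous => i; exact: coord_continuous.
    exact: closed_eq.
  have c3 : closed (\bigcap_(i in [set i | tnth x i = v]) [set w :
    'rV[R]_n | w 0 i = 0]).
    apply: closed_bigI => i _.
    apply: (@preimage_closed _ _ (fun w : 'rV[R]_n => w 0 i) [set t | t = 0]).
      by move=> w _; exact: coord_continuous.
    exact: closed_eq.
  exact: closedI (closedI c1 c2) c3.
pose f (w : 'rV[R]_n) := \sum_l (v 0 l - \sum_i w 0 i * tnth x i 0 l) * (v 0 l -
  \sum_i w 0 i * tnth x i 0 l).
have fE w : f w = dotp (v - y w) (v - y w).
  apply: eq_bigr => l _; rewrite !mxE summxE.
  by congr (_ * _); congr (_ - _); apply: eq_bigr => i _; rewrite mxE.
have cf : continuous f.
  apply: sum_continuous => l w.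
  have c1 : {for w, continuous (fun w :
    'rV[R]_n => v 0 l - \sum_i w 0 i * tnth x i 0 l)}.
    apply: continuousB; first exact: cst_continuous.
    apply: sum_continuous => i w'; apply: continuousM.
      exact: coord_continuous.
    exact: cst_continuous.
  exact: (continuousM c1 c1).
have [w0 w0A wmin] := EVT_min_rV A0 cA (continuous_subspaceT cf).
rewrite inE in w0A; set p := y w0; pose u := v - p.
have [w0ge w0sum w0v] := w0A.
have pv : p <> v.
  have [] : (convex_hull [set` x] `\ v) p; last by [].
  apply: convex_set_sum => //; first exact: convex_hull_remove_vertex.
  move=> i wi; split; last by move=> /= e; move/eqP: wi; apply; exact: w0v.
  by apply: sub_gen_smallest => /=; rewrite mem_tnth.
exists u; first by rewrite subr_eq0; apply/eqP => vp; exact: pv.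
move=> j; have [->//|xjv] := pselect (tnth x j = v).
pose z := tnth x j - p.
have uz : dotp u z <= 0.
  rewrite leNgt; apply/negP => uz.
  have key t : 0 <= t <= 1 -> 2 * t * dotp u z <= t ^+ 2 * dotp z z.
    move=> /andP[t0 t1]; pose wt := (1 - t) *: w0 + t *: delta_mx 0 j.
    have wtE i : wt 0 i = (1 - t) * w0 0 i + t * (delta_mx 0 j : 'rV[R]_n) 0 i.
      by rewrite mxE [X in X + _]mxE [X in _ + X]mxE.
    have wtA : A wt.
      have [d1 d2 d3] := deltaA j xjv; split.
      - move=> i; rewrite wtE.
        by rewrite addr_ge0// mulr_ge0// subr_ge0.
      - under eq_bigr do rewrite wtE.
        by rewrite big_split/= -!mulr_sumr w0sum d2 !mulr1 subrK.
      - move=> i iv; rewrite wtE.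
        by rewrite w0v// d3// !mulr0 addr0.
    have := wmin wt; rewrite inE => /(_ wtA); rewrite !fE.
    have -> : v - y wt = u + (- t) *: z.
      rewrite /u /z /p /y.
      have -> : \sum_i wt 0 i *: tnth x i = (1 - t) *: (\sum_i w0 0 i *:
        tnth x i) + t *: tnth x j.
        have -> : tnth x j = \sum_i (delta_mx 0 j : 'rV[R]_n) 0 i *: tnth x i.
          rewrite (bigD1 j)//= mxE !eqxx scale1r big1 ?addr0// => i /negbTE ij.
          by rewrite mxE ij andbF scale0r.
        rewrite !scaler_sumr -big_split/=; apply: eq_bigr => i _.
        by rewrite wtE scalerDl !scalerA.
      by apply/rowP => l; rewrite !mxE; ring.
    by rewrite -/p -/u dotp_add_scale; lra.
  have zz : 0 < dotp z z.
    by have := key 1; rewrite ler01 lexx => /(_ isT); lra.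
  (* a suitable move from [p] towards [tnth x j] would come closer to [v] *)
  have [uzz|uzz] := leP (dotp u z) (dotp z z).
    have t1 : 0 <= dotp u z / dotp z z <= 1.
      by rewrite divr_ge0 ?(ltW uz) ?(ltW zz)//= ler_pdivrMr// mul1r.
    have := key _ t1; set t := _ / _ => kt.
    have tz : t * dotp z z = dotp u z by rewrite /t mulfVK// gt_eqF.
    have t0 : 0 < t by rewrite divr_gt0.
    have : t * dotp u z <= 0.
      by have e : t ^+ 2 * dotp z z = t * dotp u z; [rewrite expr2 -mulrA tz|lra].
    by rewrite leNgt mulr_gt0.
  by have := key 1; rewrite ler01 lexx => /(_ isT); lra.
have : dotp u v - dotp u p = dotp u u by rewrite -dotpBr.
have : dotp u z = dotp u (tnth x j) - dotp u p by rewrite -dotpBr.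
by have := dotp_ge0 u; lra.
Qed.

End support.

(** * A container for the vertices of a convex hull *)

Section hull_container.
Context (R : realType) (D : nat).

Definition signed_axis : finType := ('I_D.+2 * bool)%type.

Definition hull_code (N : nat) : finType := {ffun signed_axis -> pattern_type D N}.

(** The container of a pattern is built around an arbitrary function with that
    pattern. *)
Definition pattern_repr N (P : pattern_type D N) : 'rV[R]_D.+1 -> R :=
  xget (fun=> 0) [set g : 'rV[R]_D.+1 -> R | lip_concave g /\ pattern N g = P].

Lemma lip_concave_cst0 : lip_concave (fun=> 0 : R) (D := D.+1).
Proof.
split; first by rewrite normr0.
move=> y; exists 0; split => [l|y']; first by rewrite mxE normr0.
by rewrite big1 ?addr0// => l _; rewrite mxE mul0r.
Qed.

Lemma pattern_repr_lip N P : lip_concave (@pattern_repr N P).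
Proof.
by rewrite /pattern_repr; case: xgetP => [g _ []|_]; [|exact: lip_concave_cst0].
Qed.

Lemma pattern_reprK N (g : 'rV[R]_D.+1 -> R) : lip_concave g ->
  pattern N g = pattern N (pattern_repr (pattern N g)).
Proof.
move=> gc; rewrite /pattern_repr.
by have [] := @xgetPex _ (fun=> 0) [set h : 'rV[R]_D.+1 ->
  R | lip_concave h /\ pattern N h = pattern N g]
  (ex_intro _ g (conj gc erefl)).
Qed.

Definition hull_container N (kappa : hull_code N) : set 'rV[R]_D.+2 :=
  \big[setU/set0]_(p : signed_axis) graph_container N p.2 p.1 (pattern_repr (kappa p)).

Lemma measurable_hull_container N kappa : measurable (@hull_container N kappa).
Proof. by apply: bigsetU_measurable => p _; exact: measurable_graph_container. Qed.

Lemma lebesgue_hull_container N kappa : (0 < N)%N ->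
  (lebesgue_rV (@hull_container N kappa) <=
    ((2 * D.+2 * graph_volume_const D)%:R * N%:R ^- 2)%:E)%E.
Proof.
move=> N0; apply: (le_trans (measure_bigsetU_le _ _ _)).
  by move=> p; exact: measurable_graph_container.
apply: (@le_trans _ _ (\sum_(p :
  signed_axis) ((graph_volume_const D)%:R * N%:R ^- 2)%:E)%E).
  by apply: lee_sum => p _; apply: lebesgue_graph_container => //;
    exact: pattern_repr_lip.
rewrite sumEFin lee_fin sumr_const card_prod card_ord card_bool.
by rewrite -[leLHS]mulr_natl mulrA -natrM mulnC [(D.+2 * 2)%N]mulnC mulnC.
Qed.

Lemma card_hull_code : exists C : nat, forall N, (0 < N)%N ->
  (#|hull_code N| <= C ^ (N ^ D.+1))%N.
Proof.
have [C CP] := card_pattern_type D; exists (C ^ (D.+2 * 2))%N => N N0.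
rewrite card_ffun card_prod card_ord card_bool.
have -> : ((C ^ (D.+2 * 2)) ^ (N ^ D.+1) = (C ^ (N ^ D.+1)) ^ (D.+2 * 2))%N.
  by rewrite -!expnM mulnC.
by rewrite leq_exp2r// CP.
Qed.

Definition supported_along (p : signed_axis) (X : set 'rV[R]_D.+2) (a : 'rV[R]_D.+2)
    (u : 'rV[R]_D.+2) :=
  [/\ u 0 p.1 = (-1) ^+ p.2, forall l, `|u 0 l| <= 1 &
    forall b, X b -> dotp u b <= dotp u a].

(** The axis is the coordinate at which the support functional is largest in
    absolute value. *)
Lemma exists_supported_along X a u : u != 0 ->
  (forall b, X b -> dotp u b <= dotp u a) -> exists p w, supported_along p X a w.
Proof.
move=> u0 ua; pose k : 'I_D.+2 := [arg max_(i > ord0) `|u 0 i|]%O.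
have kmax l : `|u 0 l| <= `|u 0 k|.
  by rewrite /k; case: arg_maxP => // i _ imax; exact: imax.
have uk : 0 < `|u 0 k|.
  rewrite lt_neqAle normr_ge0 andbT eq_sym; apply: contra u0 => /eqP uk.
  apply/eqP/rowP => l; rewrite mxE; apply/eqP; rewrite -normr_le0.
  by apply: (le_trans (kmax l)); rewrite uk.
exists (k, u 0 k < 0), (`|u 0 k|^-1 *: u); split => /=.
- rewrite mxE; have [ukn|ukp] := ltrP (u 0 k) 0.
    by rewrite expr1 ltr0_norm// invrN mulNr mulVf// lt_eqF.
  by rewrite expr0 ger0_norm// mulVf//; move: uk; rewrite normr_gt0.
- by move=> l; rewrite mxE normrM normfV normr_id ler_pdivrMl// mulr1.
- by move=> b Xb; rewrite ![dotp (_ *: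
  _) _]dotpC !dotpZr ler_pM2l ?invr_gt0// ![dotp _ u]dotpC ua.
Qed.

(** The function is the lower envelope of the supporting hyperplanes, written as
    graphs over the axis; each of the points lies on its own hyperplane and
    below the others. *)
Lemma supported_points_on_graph n (x : n.-tuple 'rV[R]_D.+2) (p : signed_axis) :
  exists2 g : 'rV[R]_D.+1 -> R, lip_concave g &
  forall i, (forall l, `|tnth x i 0 l| <= 1) ->
    (exists u, supported_along p [set` x] (tnth x i) u) ->
    tnth x i 0 p.1 = (-1) ^+ p.2 * g (col' p.1 (tnth x i)).
Proof.
case: p => k b /=; set s : R := (-1) ^+ b.
have ss : s * s = 1 by rewrite -expr2 sqrr_sign.
pose Q i u := (forall l, `|tnth x i 0 l| <= 1) /\
  supported_along (k, b) [set` x] (tnth x i) u.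
have [u Pu] : {u : 'I_n -> 'rV[R]_D.+2 & forall i, (exists w, Q i w) -> Q i (u i)}.
  exists (fun i => xget 0 [set w | Q i w]) => i Pi.
  exact: (@xgetPex _ 0 [set w | Q i w]).
pose P i := `[< exists w, Q i w >].
have [[i0 Pi0]|noP] := pselect (exists i, P i); last first.
  exists (fun=> 0); first exact: lip_concave_cst0.
  move=> i xi1 [w wi]; exfalso; apply: noP; exists i.
  by apply/asboolP; exists w.
pose a i (y : 'rV[R]_D.+1) := s * tnth x i 0 k +
  \sum_l u i 0 (lift k l) * (tnth x i 0 (lift k l) - y 0 l).
pose m y : 'I_n := [arg min_(i < i0 | P i) a i y]%O.
have mP y : P (m y) /\ forall j, P j -> a (m y) y <= a j y.
  by rewrite /m; case: arg_minP => // i Pi imin; split.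
have PQ i : P i -> Q i (u i) by move=> /asboolP; exact: Pu.
exists (fun y => a (m y) y).
  split.
    have [[x1 [_ u1 _]]] : Q (m 0) (u (m 0)) /\ True.
      by split => //; apply: PQ; have [] := mP 0.
    move=> _; rewrite /a; apply: (le_trans (ler_normD _ _)).
    rewrite -[leRHS](natr1) addrC lerD//; last first.
      by rewrite normrM normr_sign mul1r.
    apply: (le_trans (ler_norm_sum _ _ _)).
    apply: (@le_trans _ _ (\sum_(l < D.+1) 1)); last by rewrite sumr_const card_ord.
    apply: ler_sum => l _; rewrite mxE subr0 normrM.
    by rewrite -[leRHS]mul1r ler_pM.
  move=> y; exists (\row_l - u (m y) 0 (lift k l)).
  have [Pm _] := mP y; have [_ [_ u1 _]] := PQ _ Pm.
  split => [l|y']; first by rewrite mxE normrN.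
  have [_ mmin] := mP y'; apply: (le_trans (mmin _ Pm)).
  rewrite /a -addrA lerD2l -big_split/=; apply: ler_sum => l _.
  by rewrite mxE le_eqVlt; apply/orP; left; apply/eqP; ring.
move=> i xi1 iC; have Pi : P i.
  by apply/asboolP; have [w wi] := iC; exists w.
suff -> : a (m (col' k (tnth x i))) (col' k (tnth x i)) = s * tnth x i 0 k.
  by rewrite mulrA ss mul1r.
have [Pm mmin] := mP (col' k (tnth x i)); apply/eqP; rewrite eq_le.
have ai : a i (col' k (tnth x i)) = s * tnth x i 0 k.
  by rewrite /a big1 ?addr0// => l _; rewrite mxE subrr mulr0.
rewrite -{1}ai mmin//=; have [_ [us _ ux]] := PQ _ Pm.
set j := m _ in us ux *.
have := ux (tnth x i); rewrite /= mem_tnth => /(_ isT).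
rewrite /dotp !(bigD1_ord k)//= us -/s /a => h.
under eq_bigr => l _ do rewrite mxE mulrBr.
by rewrite sumrB; lra.
Qed.

Lemma vertices_in_hull_container N n (x : n.-tuple 'rV[R]_D.+2) : (0 < N)%N ->
  exists kappa, forall i, (forall l, `|tnth x i 0 l| <= 1) ->
    vertices (convex_hull [set` x]) (tnth x i) ->
    @hull_container N kappa (tnth x i).
Proof.
move=> N0.
have [g gP] : {g : signed_axis -> 'rV[R]_D.+1 -> R & forall p, lip_concave (g p) /\
  forall i, (forall l, `|tnth x i 0 l| <= 1) ->
    (exists u, supported_along p [set` x] (tnth x i) u) ->
    tnth x i 0 p.1 = (-1) ^+ p.2 * g p (col' p.1 (tnth x i))}.
  apply: (@choice _ _ (fun p (g : 'rV[R]_D.+1 -> R) => lip_concave g /\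
  forall i, (forall l, `|tnth x i 0 l| <= 1) ->
    (exists u, supported_along p [set` x] (tnth x i) u) ->
    tnth x i 0 p.1 = (-1) ^+ p.2 * g (col' p.1 (tnth x i)))) => p.
  by have [g ? ?] := supported_points_on_graph x p; exists g.
exists [ffun p => pattern N (g p)] => i x1 Vi.
have [u u0 ux] := vertex_support (ltn0Sn _) Vi.
have [|p [w pw]] := @exists_supported_along [set` x] (tnth x i) u u0.
  by move=> b /= /tnthP[j ->].
rewrite /hull_container -bigcup_seq/=; exists p; first exact: mem_index_enum.
rewrite ffunE; have [gc gx] := gP p.
apply: (graph_container_cover N0 gc) => //.
- exact: pattern_repr_lip.
- exact: pattern_reprK.
- by apply: gx => //; exists w.
Qed.

End hull_container.

(** * Exponential moments of the number of vertices *)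

(** The integral of a nonnegative function is by definition a supremum over the
    simple functions below it, so it is monotone without measurability; this
    spares proving that the number of vertices is measurable. *)
Lemma le_lower_integral d (T : measurableType d) (R : realType)
    (mu : {measure set T -> \bar R}) (f g : T -> \bar R) :
  (forall x, 0 <= f x)%E -> (forall x, f x <= g x)%E ->
  (\int[mu]_x f x <= \int[mu]_x g x)%E.
Proof.
move=> f0 fg; have g0 x : (0 <= g x)%E by exact: le_trans (fg x).
rewrite !ge0_integralE//; apply: ge_ereal_sup => _ [h hf <-].
apply: ereal_sup_ubound; exists h => // x; apply: (le_trans (hf x)).
by rewrite !patch_setT.
Qed.

Section iid.
Context d (T : measurableType d) (R : realType) (P : probability T R) (n : nat).

Lemma prod_indic_sum (B : set T) (x : n.-tuple T) :
  \prod_(i < n) (1 + \1_B (tnth x i)) = \sum_(J : {set 'I_n})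
    \1_[set t : n.-tuple T | forall i, (if i \in J then B else setT) (tnth t i)] x :> R.
Proof.
under eq_bigr do rewrite addrC.
rewrite bigA_distr; apply: eq_bigr => J _.
rewrite indicE; have [/set_mem /= xJ|xJ] := boolP (x \in _).
  rewrite big1// => i _; have := xJ i; case: ifP => // _ Bi.
  by rewrite indicE mem_set.
have /existsNP[i] : ~ [set t : n.-tuple T | forall i,
  (if i \in J then B else setT) (tnth t i)] x.
  by move=> /mem_set; apply/negP.
case: ifPn => [iJ nB|_ []//].
by rewrite (bigD1 i)//= iJ indicE memNset// mul0r.
Qed.

Lemma measurable_prod_indic (B : set T) : measurable B ->
  measurable_fun setT (fun x : n.-tuple T => \prod_(i < n) (1 + \1_B (tnth x i)) : R).
Proof.
move=> mB; under eq_fun do rewrite prod_indic_sum.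
apply: measurable_sum => J; apply: measurable_indic.
by apply: (@measurable_box _ _ n (fun i => if i \in J then B else setT)) => i;
  case: ifP.
Qed.

(** The integrand is [2] to the power of the number of points in [B], a binomial
    variable. *)
Lemma integral_prod_indic (B : set T) : measurable B ->
  (\int[iid_law P n]_x (\prod_(i < n) (1 + \1_B (tnth x i)))%:E =
    ((1 + fine (P B)) ^+ n)%:E)%E.
Proof.
move=> mB; have mJ (J : {set 'I_n}) i : measurable (if i \in J then B else setT).
  by case: ifP.
have mbox (J : {set 'I_n}) : measurable
    [set t : n.-tuple T | forall i, (if i \in J then B else setT) (tnth t i)].
  exact: (measurable_box (mJ J)).
under eq_integral do rewrite prod_indic_sum -sumEFin.
rewrite ge0_integral_sum//=; last first.
  by move=> J; apply/measurable_EFinP; exact: measurable_indic.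
rewrite -[in RHS](card_ord n) -prodr_const.
under [in RHS]eq_bigr do rewrite addrC.
rewrite bigA_distr -sumEFin; apply: eq_bigr => J _.
rewrite integral_indic// setIT [LHS](power_measure_box P (mJ J)).
rewrite (eq_bigr (fun i => (if i \in J then fine (P B) else 1)%:E)) => [|i _].
  by rewrite -(big_morph EFin EFinM erefl).
case: ifP => _; last exact: probability_setT.
by rewrite fineK// fin_num_measure.
Qed.

End iid.

Lemma expn_le_exp2 q s : (0 < q)%N -> (s.+1 ^ q <= q ^ q * 2 ^ s)%N.
Proof.
move=> q0; have h : (s.+1 <= q * 2 ^ (s %/ q))%N.
  apply: (@leq_trans (q * (s %/ q).+1)); first by rewrite mulnC ltn_ceil.
  by rewrite leq_mul2l ltn_expl// orbT.
apply: (@leq_trans ((q * 2 ^ (s %/ q)) ^ q)); first by rewrite leq_exp2r.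
by rewrite expnMn leq_mul2l -expnM leq_pexp2l ?orbT// leq_trunc_div.
Qed.

(** Either [r <= T] and the first summand suffices, or [r = T + s] with
    [T + s <= T (1 + s)], and [(1 + s) ^ q] is at most [q ^ q 2 ^ s]. *)
Lemma expn_le_majorant q r T : (0 < q)%N -> (0 < T)%N ->
  (r ^ q * 2 ^ T <= q ^ q * T ^ q * (2 ^ T + 2 ^ r))%N.
Proof.
move=> q0 T0; have qq : (0 < q ^ q)%N by rewrite expn_gt0 q0.
have [rT|/ltnW Tr] := leqP r T.
  apply: (@leq_trans (T ^ q * 2 ^ T)); first by rewrite leq_mul2r leq_exp2r// rT orbT.
  rewrite mulnDr; apply: leq_trans (leq_addr _ _).
  by rewrite -mulnA leq_pmull.
rewrite -(subnKC Tr); set s := (r - T)%N.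
have h : (T + s <= T * s.+1)%N by nia.
apply: (@leq_trans ((T * s.+1) ^ q * 2 ^ T));
  first by rewrite leq_mul2r leq_exp2r// h orbT.
have h2 := expn_le_exp2 s q0.
rewrite expnMn mulnDr; apply: leq_trans (leq_addl _ _).
rewrite expnD [(q ^ q * _)%N]mulnC -!mulnA leq_mul2l [(2 ^ T * _)%N]mulnC mulnA.
by rewrite leq_mul2r h2 !orbT.
Qed.

Section upper_bound.
Context (R : realType) (D : nat).

Definition cube : set 'rV[R]_D.+2 := [set x | forall l, `[-1, 1]%classic (x 0 l)].

Lemma measurable_cube : measurable cube.
Proof. by apply: (@measurable_rV_box R D.+2 (fun=> `[-1, 1]%classic)) => i;
  exact: measurable_itv. Qed.

Lemma cubeP x : cube x <-> forall l, `|x 0 l| <= 1.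
Proof.
split => h l; have := h l; first by rewrite /= in_itv/= ler_norml.
by rewrite /= in_itv/= ler_norml.
Qed.

Lemma unit_ball_cube : @unit_ball R D.+2 `<=` cube.
Proof.
move=> x; rewrite /unit_ball/=; set s := \sum_(i < _) _ => s1; apply/cubeP => l.
have s0 : 0 <= s by apply: sumr_ge0 => i _; exact: sqr_ge0.
have {}s1 : s <= 1.
  by rewrite -(sqr_sqrtr s0) expr_le1// sqrtr_ge0.
have : x 0 l ^+ 2 <= 1.
  by apply: le_trans s1; rewrite /s (bigD1 l)//= lerDl sumr_ge0// => i _;
    exact: sqr_ge0.
by rewrite -(real_normK (num_real _)) expr_le1.
Qed.

(** Adding the complement of the cube costs nothing, and allows treating all
    samples alike, including those with points outside the body. *)
Lemma density_law_le (f : density R D.+2) (K A : set 'rV[R]_D.+2) (M v : R) :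
  0 <= M -> K `<=` cube -> f \in bounded_densities K M -> measurable A ->
  (lebesgue_rV A <= v%:E)%E -> (density_law f (A `|` ~` cube) <= (M * v)%:E)%E.
Proof.
move=> M0 Kc; rewrite inE => -[fK fM] mA Av.
have mf : measurable_fun setT (fun x => (f x)%:E).
  by apply/measurable_EFinP; exact: measurable_pdf.
have mC : measurable (~` cube) by apply: measurableC; exact: measurable_cube.
apply: (@le_trans _ _ (density_law f A + density_law f (~` cube))%E).
  exact: measureU2.
have -> : density_law f (~` cube) = 0%E.
  rewrite /density_law (eq_integral (fun=> 0%E)) ?integral0// => x; rewrite inE => xC.
  by rewrite fK// => /Kc.
rewrite adde0 /density_law; apply:
  (@le_trans _ _ (\int[@lebesgue_rV R D.+2]_(x in A) M%:E)%E).
  apply: ge0_le_integral => //.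
  - by move=> x _; rewrite lee_fin pdf_ge0.
  - exact: measurable_funTS.
  - by move=> x _; rewrite lee_fin.
by rewrite integral_cst// EFinM; apply: lee_wpmul2l; rewrite ?lee_fin.
Qed.

Lemma nb_vertices_le_count n (x : n.-tuple 'rV[R]_D.+2) (B : set 'rV[R]_D.+2) :
  vertices (convex_hull [set` x]) `<=` B ->
  (2 ^ nb_vertices x)%:R <= \prod_(i < n) (1 + \1_B (tnth x i)) :> R.
Proof.
move=> VB; pose s := [seq z <- x | z \in B].
have Vs : vertices (convex_hull [set` x]) `<=` [set` s].
  move=> v Vv; rewrite /= mem_filter mem_set; last exact: VB.
  exact: (vertices_convex_hull Vv).
have nbs : (nb_vertices x <= size s)%N.
  apply: (leq_trans _ (size_undup s)).
  rewrite -(size_seq_fset tt); apply: fsubset_leq_card.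
  apply/fsubsetP => v; rewrite in_fset_set; last first.
    exact: (sub_finite_set Vs).
  by move=> /set_mem/Vs vs; rewrite seq_fsetE.
apply: (@le_trans _ _ (2 ^ size s)%:R); first by rewrite ler_nat leq_pexp2l.
rewrite -(big_tuple _ _ x xpredT (fun z => 1 + \1_B z)) /s.
elim: (tval x) => [|z t IH]; first by rewrite big_nil.
rewrite big_cons /=; case: ifPn => [zB|zB] /=.
  rewrite expnS natrM indicE zB ler_wpM2l//.
by rewrite indicE (negbTE zB) addr0 mul1r.
Qed.

(** [2 ^ R_n] is at most the sum over the containers of [2] to the power of the
    number of sample points inside, whatever the sample. *)
Lemma moment_nb_vertices_le (f : density R D.+2) (K : set 'rV[R]_D.+2) (M : R)
    (N n q T : nat) : (0 < N)%N -> (0 < q)%N -> (0 < T)%N -> 0 <= M ->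
  K `<=` @unit_ball R D.+2 -> f \in bounded_densities K M ->
  #|hull_code D N|%:R * (1 + M * ((2 * D.+2 * graph_volume_const D)%:R * N%:R ^-
    2)) ^+ n
    <= 2 ^+ T ->
  (moment_nb_vertices f n q <= (2 * (q ^ q * T ^ q)%:R)%:E)%E.
Proof.
move=> N0 q0 T0 M0 Kb fK hT.
set V := _%:R * N%:R ^- 2 in hT.
have Kc : K `<=` cube by apply: (subset_trans Kb); exact: unit_ball_cube.
pose B (kappa : hull_code D N) := @hull_container R D N kappa `|` ~` cube.
have mB kappa : measurable (B kappa).
  apply: measurableU; first exact: measurable_hull_container.
  by apply: measurableC; exact: measurable_cube.
have PB kappa : fine (density_law f (B kappa)) <= M * V.
  have h := density_law_le M0 Kc fK (@measurable_hull_container R D N kappa)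
    (@lebesgue_hull_container R D N kappa N0).
  by rewrite -lee_fin fineK// fin_num_measure.
pose G (x : n.-tuple 'rV[R]_D.+2) : R :=
  (q ^ q * T ^ q)%:R + (q ^ q * T ^ q)%:R / 2 ^+ T *
  \sum_(kappa : hull_code D N) \prod_(i < n) (1 + \1_(B kappa) (tnth x i)).
have RG x : (nb_vertices x)%:R ^+ q <= G x.
  have [kappa kP] := vertices_in_hull_container x N0.
  have VB : vertices (convex_hull [set` x]) `<=` B kappa.
    move=> v Vv; have [vc|vc] := pselect (cube v); [left|by right].
    have /tnthP[i vi] := vertices_convex_hull Vv.
    by rewrite vi; apply: kP; rewrite -vi//; exact/cubeP.
  have h1 := nb_vertices_le_count VB.
  have h2 := expn_le_majorant (nb_vertices x) q0 T0.
  rewrite -(ler_nat R) !(natrM, natrD, natrX) in h2.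
  have T2 : 0 < 2 ^+ T :> R by rewrite exprn_gt0.
  rewrite -(ler_pM2r T2); apply: (le_trans h2).
  have h3 : 2 ^+ nb_vertices x <=
      \sum_(kappa : hull_code D N) \prod_(i < n) (1 + \1_(B kappa) (tnth x i)) :> R.
    rewrite -natrX; apply: (le_trans h1); rewrite (bigD1 kappa)//= lerDl.
    by apply: sumr_ge0 => k _; apply: prodr_ge0 => i _; rewrite addr_ge0.
  rewrite /G; set S := \sum_(k : hull_code D N) _ in h3 *.
  have -> : ((q ^ q * T ^ q)%:R + (q ^ q * T ^ q)%:R / 2 ^+ T * S) * 2 ^+ T =
    (q ^ q * T ^ q)%:R * (2 ^+ T + S) :> R by field; rewrite gt_eqF.
  by rewrite natrM !natrX ler_wpM2l ?mulr_ge0 ?exprn_ge0// lerD2l.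
have T2 : 0 < 2 ^+ T :> R by rewrite exprn_gt0.
set c := (q ^ q * T ^ q)%:R in G RG *.
have c0 : 0 <= c :> R by rewrite ler0n.
rewrite /moment_nb_vertices unlock.
apply: (@le_trans _ _ (\int[iid_law (density_law f) n]_x (G x)%:E)%E).
  by apply: le_lower_integral => x; rewrite lee_fin ?exprn_ge0// RG.
have mS kappa : measurable_fun [set: n.-tuple 'rV[R]_D.+2]
    (fun x => (\prod_(i < n) (1 + \1_(B kappa) (tnth x i)) : R)%:E).
  by apply/measurable_EFinP; exact: measurable_prod_indic.
have S0 kappa (x : n.-tuple 'rV[R]_D.+2) :
    (0 <= (\prod_(i < n) (1 + \1_(B kappa) (tnth x i)) : R)%:E)%E.
  by rewrite lee_fin; apply: prodr_ge0 => i _; rewrite addr_ge0.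
rewrite /G.
under eq_integral do rewrite EFinD EFinM -sumEFin.
have mSS : measurable_fun [set: n.-tuple 'rV[R]_D.+2]
  (fun x => \sum_(kappa : hull_code D N) (\prod_(i < n) (1 + \1_(B kappa) (tnth x
    i)) : R)%:E)%E.
  exact: emeasurable_sum.
have cT : (0 <= (c / 2 ^+ T)%:E)%E by rewrite lee_fin divr_ge0// ltW.
rewrite ge0_integralD//=; last 2 first.
- by move=> x _; rewrite mule_ge0// sume_ge0.
- by apply: emeasurable_funM => //.
rewrite integral_cst// ge0_integralZl//=; last by move=> x _; rewrite sume_ge0.
rewrite [X in (_ * X + _)%E](_ : _ = 1%E); last exact: probability_setT.
rewrite mule1 ge0_integral_sum//.
under eq_bigr do rewrite (integral_prod_indic (density_law f) n (mB _)).
rewrite sumEFin -EFinM -EFinD lee_fin.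
have h : \sum_(k : hull_code D N) (1 + fine (density_law f (B k))) ^+ n <= 2 ^+ T.
  apply: le_trans hT; rewrite mulr_natl -sumr_const.
  apply: ler_sum => k _; rewrite lerXn2r// ?nnegrE ?addr_ge0//.
  - exact: fine_ge0.
  - by rewrite mulr_ge0// /V mulr_ge0.
  - by rewrite lerD2l.
rewrite (_ : 2 * c = c + c / 2 ^+ T * 2 ^+ T); last by field; rewrite gt_eqF.
by rewrite lerD2l ler_wpM2l// divr_ge0// ltW.
Qed.

End upper_bound.

Lemma moment_nb_vertices_upper (R : realType) (D q : nat) (M : R) : 0 < M ->
  (0 < q)%N ->
  exists U : R, forall (N n : nat) (K : set 'rV[R]_D.+2) (f : density R D.+2),
    (0 < N)%N -> (n < N.+1 ^ D.+3)%N ->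
    K `<=` @unit_ball R D.+2 -> f \in bounded_densities K M ->
    (moment_nb_vertices f n q <= (U * (N ^ D.+1)%:R ^+ q)%:E)%E.
Proof.
move=> M0 q0; have [C CP] := card_hull_code D.
pose V : R := (2 * D.+2 * graph_volume_const D)%:R.
pose a := M * V * 2 ^+ D.+3.
have V0 : 0 <= V by rewrite ler0n.
pose k := (Num.truncn (expR a)).+1.
have ka : expR a <= 2 ^+ k.
  apply: (@le_trans _ _ k%:R).
    by rewrite ltW//; have /andP[] := truncn_itv (expR_ge0 a).
  by rewrite -natrX ler_nat ltnW// ltn_expl.
exists (2 * (q ^ q * (C + k).+1 ^ q)%:R) => N n K f N0 nN Kb fK.
have Np : 0 < N%:R :> R by rewrite ltr0n.
pose m := (N ^ D.+1)%N; have m0 : (0 < m)%N by rewrite expn_gt0 N0.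
have -> : 2 * (q ^ q * (C + k).+1 ^ q)%:R * (N ^ D.+1)%:R ^+ q =
    2 * (q ^ q * ((C + k).+1 * m) ^ q)%:R :> R.
  by rewrite -natrX -!mulrA -natrM expnMn mulnA.
apply: (@moment_nb_vertices_le _ _ f K M N) => //.
- by rewrite muln_gt0.
- exact: ltW.
rewrite -/V mulSn exprD.
have b0 : 0 <= M * (V * N%:R ^- 2).
  by rewrite mulr_ge0 ?(ltW M0)// mulr_ge0// invr_ge0 exprn_ge0.
have h1 : #|hull_code D N|%:R <= 2 ^+ (C * m) :> R.
  rewrite -natrX ler_nat; apply: (leq_trans (CP N N0)).
  by rewrite expnM leq_exp2r// ltnW// ltn_expl.
have h2 : (1 + M * (V * N%:R ^- 2)) ^+ n <= 2 ^+ (k * m).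
  apply: (@le_trans _ _ (expR (M * (V * N%:R ^- 2)) ^+ n)).
    by rewrite lerXn2r ?nnegrE ?expR_ge0 ?addr_ge0// expR_ge1Dx.
  rewrite -expRM_natl exprM; apply: (@le_trans _ _ (expR a ^+ m)); last first.
    by rewrite lerXn2r ?nnegrE ?expR_ge0 ?exprn_ge0.
  rewrite -expRM_natl ler_expR.
  have nN2 : n%:R <= 2 ^+ D.+3 * N%:R ^+ D.+3 :> R.
    rewrite -exprMn -natrM -natrX ler_nat; apply: (leq_trans (ltnW nN)).
    by rewrite leq_exp2r//; lia.
  apply: (le_trans (ler_wpM2r b0 nN2)); rewrite /a /m natrX !exprS.
  rewrite le_eqVlt; apply/orP; left; apply/eqP; field; by rewrite gt_eqF.
apply: (@le_trans _ _ (2 ^+ (C * m) * 2 ^+ (k * m))).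
  by apply: ler_pM => //; rewrite exprn_ge0// addr_ge0.
rewrite -exprD -mulnDl -[leLHS]mul1r ler_wpM2r ?exprn_ge0//.
by rewrite exprn_ege1// ler1n.
Qed.

(** * The paraboloid and its caps *)

Section strictly_convex_vertex.
Context (R : realType) (d : nat).

Lemma dotp_convex (a b : 'rV[R]_d) (t : R) :
  dotp (t *: a + (1 - t) *: b) (t *: a + (1 - t) *: b) =
  t * dotp a a + (1 - t) * dotp b b - t * (1 - t) * dotp (a - b) (a - b).
Proof.
have -> : t *: a + (1 - t) *: b = b + t *: (a - b).
  by apply/rowP => i; rewrite !mxE; ring.
have -> : a = b + 1 *: (a - b) by rewrite scale1r addrC subrK.
rewrite !dotp_add_scale [b + _ - b]addrC addKr scale1r; ring.
Qed.

(** The function is strictly convex: on a nontrivial segment through a maximizer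
    it would be larger at one of the ends. *)
Lemma argmax_vertex n (x : n.-tuple 'rV[R]_d) (w : 'rV[R]_d) (h : R) v :
  0 < h -> v \in x ->
  (forall j, j \in x -> dotp w j + h * dotp j j <= dotp w v + h * dotp v v) ->
  vertices (convex_hull [set` x]) v.
Proof.
move=> h0 vx vmax; pose phi z := dotp w z + h * dotp z z.
have phiE a b t : phi (t *: a + (1 - t) *: b) =
    t * phi a + (1 - t) * phi b - h * (t * (1 - t) * dotp (a - b) (a - b)).
  by rewrite /phi dotp_convex [dotp w _]dotpDr !dotpZr; ring.
have phihull : convex_hull [set` x] `<=` [set z | phi z <= phi v].
  apply: smallest_sub; last by move=> j; exact: vmax.
  apply: convex_set01 => a b t pa pb /andP[t0 t1] /=.
  have tt : 0 <= h * (t * (1 - t) * dotp (a - b) (a - b)).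
    by rewrite mulr_ge0 ?(ltW h0)// mulr_ge0 ?dotp_ge0// mulr_ge0 ?(ltW t0)//
      subr_ge0 ltW.
  have h1 : t * phi a <= t * phi v by rewrite ler_pM2l.
  have h2 : (1 - t) * phi b <= (1 - t) * phi v by rewrite ler_pM2l// subr_gt0.
  rewrite phiE; lra.
split; first by apply: sub_gen_smallest.
move=> a b t Aa Ab /andP[t0 t1] vE.
have h1 : t * phi a <= t * phi v by rewrite ler_pM2l//; exact: phihull.
have h2 : (1 - t) * phi b <= (1 - t) * phi v by rewrite ler_pM2l ?subr_gt0//;
  exact: phihull.
have := phiE a b t; rewrite -vE => vphi.
have ht : 0 < h * (t * (1 - t)) by rewrite !mulr_gt0// subr_gt0.
have : h * (t * (1 - t)) * dotp (a - b) (a - b) <= 0 by rewrite -mulrA; lra.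
rewrite pmulr_rle0// => abn.
have ab : a = b.
  apply/eqP; rewrite -subr_eq0; apply/eqP/dotp_eq0/eqP.
  by rewrite eq_le abn dotp_ge0.
by rewrite vE ab -scalerDl addrC subrK scale1r.
Qed.

End strictly_convex_vertex.

Section paraboloid.
Context (R : realType) (D : nat).

Definition paraboloid : set 'rV[R]_D.+2 :=
  [set x | \sum_l x 0 (lift ord0 l) ^+ 2 <= x 0 ord0 <= 2^-1].

Lemma dotp_lift (u v : 'rV[R]_D.+2) :
  dotp u v = u 0 ord0 * v 0 ord0 + \sum_l u 0 (lift ord0 l) * v 0 (lift ord0 l).
Proof. by rewrite /dotp big_ord_recl. Qed.

Lemma paraboloid_dotp x : paraboloid x -> dotp x x <= 1.
Proof.
move=> /= /andP[h1 h2]; rewrite dotp_lift.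
have s0 : 0 <= \sum_l x 0 (lift ord0 l) ^+ 2 by apply: sumr_ge0 => l _; exact: sqr_ge0.
have -> : \sum_l x 0 (lift ord0 l) * x 0 (lift ord0 l) = \sum_l x 0 (lift ord0 l) ^+ 2.
  by apply: eq_bigr => l _; rewrite expr2.
by nra.
Qed.

Lemma paraboloid_unit_ball : paraboloid `<=` @unit_ball R D.+2.
Proof.
move=> x /paraboloid_dotp x1; rewrite /unit_ball/=.
have -> : \sum_i x ord0 i ^+ 2 = dotp x x by apply: eq_bigr => i _; rewrite expr2.
by rewrite -sqrtr1 ler_sqrt.
Qed.

Lemma compact_paraboloid : compact paraboloid.
Proof.
apply: bounded_closed_compact.
  exists 1; split => // M M1 x /paraboloid_unit_ball/unit_ball_cube/cubeP x1.
  rewrite /Num.norm/= mx_normrE; apply: bigmax_le => [|[i j] _/=].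
    by rewrite (le_trans _ (ltW M1)).
  by rewrite ord1 (le_trans (x1 j) (ltW M1)).
have -> : paraboloid =
   [set x : 'rV[R]_D.+2 | \sum_l x 0 (lift ord0 l) * x 0 (lift ord0 l) - x 0 ord0
     <= 0] `&`
   [set x : 'rV[R]_D.+2 | x 0 ord0 <= 2^-1].
  by apply/seteqP; split => x /=; [move=> /andP[h1 h2]|move=> [h1 h2]];
    [rewrite subr_le0; split|rewrite subr_le0 in h1; apply/andP; split].
have c0 : continuous (fun x : 'rV[R]_D.+2 => x 0 ord0) by exact: coord_continuous.
apply: closedI.
  apply: (@preimage_closed _ _ (fun x : 'rV[R]_D.+2 =>
    \sum_l x 0 (lift ord0 l) * x 0 (lift ord0 l) - x 0 ord0) [set t | t <= 0]).
    move=> w _; apply: continuousB; last exact: c0.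
    apply: sum_continuous => l z.
    have cl : {for z, continuous (fun x : 'rV[R]_D.+2 => x 0 (lift ord0 l))}.
      exact: coord_continuous.
    exact: (continuousM cl cl).
  exact: closed_le.
apply: (@preimage_closed _ _ (fun x : 'rV[R]_D.+2 => x 0 ord0) [set t | t <= 2^-1]).
  by move=> w _; exact: c0.
exact: closed_le.
Qed.

Lemma convex_paraboloid : @convex_set R 'rV[R]_D.+2 paraboloid.
Proof.
apply: convex_set01 => a b t /= /andP[a1 a2] /andP[b1 b2] /andP[t0 t1].
have h : \sum_l (t *: a + (1 - t) *: b) 0 (lift ord0 l) ^+ 2 <=
   t * (\sum_l a 0 (lift ord0 l) ^+ 2) + (1 - t) * (\sum_l b 0 (lift ord0 l) ^+ 2).
  rewrite !mulr_sumr -big_split/=; apply: ler_sum => l _; rewrite !mxE.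
  rewrite -subr_ge0; set p := a _ _; set q := b _ _.
  rewrite (_ : _ - _ = t * (1 - t) * (p - q) ^+ 2); last by ring.
  by rewrite mulr_ge0 ?sqr_ge0// mulr_ge0 ?(ltW t0)// subr_ge0 ltW.
have h1 : t * (\sum_l a 0 (lift ord0 l) ^+ 2) <= t * a 0 ord0 by rewrite ler_pM2l.
have h2 : (1 - t) * (\sum_l b 0 (lift ord0 l) ^+ 2) <= (1 - t) * b 0 ord0.
  by rewrite ler_pM2l// subr_gt0.
have h3 : t * a 0 ord0 <= t * 2^-1 by rewrite ler_pM2l.
have h4 : (1 - t) * b 0 ord0 <= (1 - t) * 2^-1 by rewrite ler_pM2l// subr_gt0.
have e : (t *: a + (1 - t) *: b) 0 ord0 = t * a 0 ord0 + (1 - t) * b 0 ord0.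
  by rewrite !mxE.
by rewrite /paraboloid/= e; apply/andP; split; lra.
Qed.

Lemma interior_paraboloid : paraboloid° !=set0.
Proof.
exists (\row_i (if i == ord0 then 4^-1 else 0)).
pose m : R := D.+1%:R; have m1 : 1 <= m by rewrite ler1n.
apply/nbhs_ballP; exists (8 * m)^-1 => /=; first by rewrite invr_gt0; lra.
move=> x; rewrite ball_rVE ?invr_gt0; last by lra.
move=> /= xb.
have r8 : (8 * m)^-1 <= 8^-1 by rewrite lef_pV2 ?posrE; lra.
have := xb ord0; rewrite mxE eqxx /ball/= => x0.
have {}x0 : `|4^-1 - x 0 ord0| <= 8^-1 by rewrite (le_trans (ltW x0)).
have sx : \sum_l x 0 (lift ord0 l) ^+ 2 <= 8^-1.
  apply: (@le_trans _ _ (\sum_(l < D.+1) (8 * m)^-1 ^+ 2)).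
    apply: ler_sum => l _; have := xb (lift ord0 l);
      rewrite mxE /ball/= sub0r normrN => xl.
    by rewrite -(real_normK (num_real (x 0 _))) lerXn2r ?nnegrE// ?invr_ge0 ?ltW//; lra.
  rewrite sumr_const card_ord -[leLHS]mulr_natl -/m.
  have -> : m * (8 * m)^-1 ^+ 2 = 8^-1 * (8 * m)^-1 by field; rewrite gt_eqF//; lra.
  have : 0 <= (8 * m)^-1 by rewrite invr_ge0; lra.
  by move: r8; move: (_^-1) => r r8 r0; lra.
by move: x0; rewrite ler_norml => /andP[? ?]; apply/andP; split; lra.
Qed.

Definition paraboloid_body : convex_body R D.+2 :=
  ConvexBody compact_paraboloid convex_paraboloid interior_paraboloid.

End paraboloid.

Lemma sum_measure_le d (T : measurableType d) (R : realType)
    (mu : {measure set T -> \bar R}) (I : finType) (F : I -> set T) (A : set T) :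
  measurable A -> (forall i, measurable (F i)) -> (forall i, F i `<=` A) ->
  (forall i j x, F i x -> F j x -> i = j) ->
  (\sum_(i : I) mu (F i) <= mu A)%E.
Proof.
move=> mA mF FA Fdisj.
have -> : (\sum_(i : I) mu (F i) = mu (\big[setU/set0]_(i : I) F i))%E.
  elim: (index_enum I) (index_enum_uniq I) => [|i r IH];
    first by rewrite !big_nil measure0.
  rewrite cons_uniq !big_cons => /andP[ir ur]; rewrite IH// measureU//.
    exact: bigsetU_measurable.
  apply/seteqP; split => // x [Fi]; rewrite -bigcup_seq => -[j /= jr Fj].
  by move: ir; rewrite (Fdisj _ _ _ Fi Fj) jr.
apply: le_measure; rewrite ?inE//; first exact: bigsetU_measurable.
by rewrite -bigcup_seq => x [i _]; exact: FA.
Qed.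

Section paraboloid_caps.
Context (R : realType) (D : nat).
Implicit Types (a : 'rV[R]_D.+1) (x : 'rV[R]_D.+2).

Definition cap_direction a : 'rV[R]_D.+2 :=
  \row_i oapp (fun l => 2 * a 0 l) (-1) (unlift ord0 i).

(** The quadratic term makes the function that defines the cap strictly convex,
    so that by [argmax_vertex] a cap hit by a sample contains a vertex of the
    hull. With the coefficient [h], it changes the height of the cap by at most
    [h], since the body lies in the unit ball. *)
Definition paraboloid_cap a (h : R) : set 'rV[R]_D.+2 := @paraboloid R D `&`
  [set x | dotp a a - h <= dotp (cap_direction a) x + h * dotp x x].

Lemma dotp_cap_direction a x :
  dotp (cap_direction a) x = - x 0 ord0 + \sum_l 2 * a 0 l * x 0 (lift ord0 l).
Proof.
rewrite dotp_lift mxE unlift_none mulN1r; congr (_ + _).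
by apply: eq_bigr => l _; rewrite mxE liftK.
Qed.

Lemma sum_sqr_dist a x : \sum_l (x 0 (lift ord0 l) - a 0 l) ^+ 2 =
  \sum_l x 0 (lift ord0 l) ^+ 2 - \sum_l 2 * a 0 l * x 0 (lift ord0 l) + dotp a a.
Proof. by rewrite -sumrB -big_split/=; apply: eq_bigr => l _; ring. Qed.

Lemma paraboloid_cap_close a h x : 0 <= h -> paraboloid_cap a h x ->
  \sum_l (x 0 (lift ord0 l) - a 0 l) ^+ 2 <= 2 * h.
Proof.
move=> h0 [Px]; rewrite /= dotp_cap_direction sum_sqr_dist => xa.
have x1 := paraboloid_dotp Px; move: Px => /= /andP[Px _].
have : h * dotp x x <= h * 1 by rewrite ler_wpM2l.
lra.
Qed.

Lemma measurable_paraboloid_cap a h : measurable (paraboloid_cap a h).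
Proof.
apply: compact_measurable_rV; apply: compact_closedI; first exact: compact_paraboloid.
apply: (@preimage_closed _ _ (fun x => dotp (cap_direction a) x + h * dotp x x)
  [set t | dotp a a - h <= t]); last exact: closed_ge.
move=> x _; have cc l : continuous (fun x : 'rV[R]_D.+2 => x 0 l) by exact:
  coord_continuous.
apply: continuousD.
  apply: sum_continuous => l z; apply: continuousM; first exact: cst_continuous.
  exact: cc.
apply: continuousM; first exact: cst_continuous.
apply: sum_continuous => l z; exact: (continuousM (cc l z) (cc l z)).
Qed.

(** Small enough for the boxes inside the caps to stay below the height [1 / 2]. *)
Definition cap_spacing : R := (6 * D.+1%:R)^-1.
Local Notation al := cap_spacing.
Definition cap_height (N : nat) : R := al ^+ 2 / (4 * N%:R ^+ 2).

Definition cap_center N (j : {ffun 'I_D.+1 -> 'I_N}) : 'rV[R]_D.+1 :=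
  \row_l (2 * al * (j l)%:R / N%:R).

Definition grid_cap N j := paraboloid_cap (@cap_center N j) (cap_height N).

Lemma cap_spacing_gt0 : 0 < al.
Proof. by rewrite invr_gt0 mulr_gt0. Qed.

Lemma cap_height_gt0 N : (0 < N)%N -> 0 < cap_height N.
Proof.
by move=> N0; rewrite divr_gt0 ?mulr_gt0 ?exprn_gt0 ?cap_spacing_gt0 ?ltr0n.
Qed.

Lemma grid_cap_disjoint N (j j' : {ffun 'I_D.+1 -> 'I_N}) x : (0 < N)%N ->
  grid_cap j x -> grid_cap j' x -> j = j'.
Proof.
move=> N0 jx j'x; apply/ffunP => l; apply/val_inj.
have Np : 0 < N%:R :> R by rewrite ltr0n.
have al0 := cap_spacing_gt0.
have close (i : {ffun 'I_D.+1 -> 'I_N}) : grid_cap i x ->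
  `|x 0 (lift ord0 l) - 2 * al * (i l)%:R / N%:R| < al / N%:R.
  move=> ix; have := paraboloid_cap_close (ltW (cap_height_gt0 N0)) ix.
  rewrite (bigD1 l)//= [cap_center _ _ _]mxE => h.
  have : 0 <= \sum_(k < D.+1 | k != l) (x 0 (lift ord0 k) - cap_center i 0 k) ^+ 2.
    by apply: sumr_ge0 => k _; exact: sqr_ge0.
  move=> h2; have : (x 0 (lift ord0 l) - 2 * al * (i l)%:R / N%:R) ^+ 2 < (al /
    N%:R) ^+ 2.
    apply: (@le_lt_trans _ _ (2 * cap_height N)); first by lra.
    rewrite /cap_height (_ : 2 * _ = 2^-1 * (al / N%:R) ^+ 2); last by field;
      rewrite gt_eqF.
    by rewrite gtr_pMl ?invf_lt1 ?ltr1n// exprn_gt0// divr_gt0.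
  by rewrite -(real_normK (num_real (_ - _))) ltr_pXn2r// nnegrE divr_ge0// ltW.
have := close _ jx; have := close _ j'x;
  rewrite !ltr_norml => /andP[h1 h2] /andP[h3 h4].
have e i : 2 * al * (i : nat)%:R / N%:R = 2 * (al / N%:R) * i%:R by ring.
rewrite !e in h1 h2 h3 h4; set g := al / N%:R in h1 h2 h3 h4.
have g0 : 0 < 2 * g by rewrite mulr_gt0// divr_gt0.
have lt1 (p q : nat) : 2 * g * p%:R - 2 * g * q%:R < 2 * g -> (p <= q)%N.
  rewrite -mulrBr -[ltRHS]mulr1 ltr_pM2l// => h.
  by rewrite -ltnS -(ltr_nat R) -natr1; lra.
by apply/eqP; rewrite eqn_leq !lt1//; lra.
Qed.

(** Small compared with [cap_spacing], so that over a subcell of side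
    [cap_mesh / N ^ 2] the tilt of the cap is a fraction of its height. *)
Definition cap_mesh : R := al / (32 * D.+1%:R).
Local Notation be := cap_mesh.

(** The side is half of the mesh so that distinct closed boxes are disjoint. *)
Definition cap_box N (j u : {ffun 'I_D.+1 -> 'I_N}) : set 'rV[R]_D.+2 :=
  let c := \row_l (cap_center j 0 l + be / N%:R ^+ 2 * (u l)%:R) in
  let H := al ^+ 2 / (32 * N%:R ^+ 2) in
  column_box ord0 c (be / N%:R ^+ 2 / 2)
    (\sum_l 2 * cap_center j 0 l * c 0 l - dotp (cap_center j) (cap_center j)
      + cap_height N - H) H.

Lemma cap_mesh_gt0 : 0 < be.
Proof. by rewrite divr_gt0 ?cap_spacing_gt0// mulr_gt0. Qed.

(** Over a subcell the upper side of the cap varies by at most a quarter of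
    [cap_height N], and the paraboloid exceeds its tangent plane at the center of
    the cap by at most an eighth; this leaves room for a box of height
    [cap_height N / 4] that ends at the lowest value of the upper side. *)
Lemma cap_box_sub N (j u : {ffun 'I_D.+1 -> 'I_N}) : (0 < N)%N ->
  cap_box j u `<=` grid_cap j.
Proof.
move=> N0 x; rewrite /cap_box /=; set a := cap_center j.
set c := \row_l _; set H := al ^+ 2 / _; set h := cap_height N.
set rho := be / N%:R ^+ 2 => xb.
have Np : 0 < N%:R :> R by rewrite ltr0n.
have N1 : 1 <= N%:R :> R by rewrite ler1n.
have al0 := cap_spacing_gt0; have be0 := cap_mesh_gt0.
have N2 : 0 < N%:R ^+ 2 :> R by rewrite exprn_gt0.
have rho0 : 0 < rho by rewrite divr_gt0.
pose m : R := D.+1%:R; have m1 : 1 <= m by rewrite ler1n.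
have mal : m * al = 6^-1 by rewrite /cap_spacing -/m; field; rewrite gt_eqF//; lra.
have mbe : m * be = al / 32 by rewrite /cap_mesh -/m; field; rewrite gt_eqF//; lra.
have beal : be <= al.
  have : 1 * be <= m * be by rewrite ler_pM2r.
  by rewrite mbe; lra.
have rhobe : rho * N%:R <= be / N%:R.
  by rewrite /rho (_ : be / N%:R ^+ 2 * N%:R = be / N%:R)//; field; rewrite gt_eqF.
have beN : be / N%:R <= be by rewrite ler_pdivrMr// ler_peMr// ltW.
have a0 l : 0 <= a 0 l by rewrite mxE !mulr_ge0// ?(ltW al0)// invr_ge0.
have a2 l : a 0 l <= 2 * al.
  rewrite mxE -mulrA ler_piMr ?mulr_ge0 ?(ltW al0)//.
  by rewrite ler_pdivrMr// mul1r ler_nat ltnW.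
have c0 l : a 0 l <= c 0 l.
  by rewrite [c 0 l]mxE lerDl mulr_ge0// ltW.
have ca l : c 0 l + rho / 2 <= a 0 l + be / N%:R.
  rewrite [c 0 l]mxE -/rho -addrA lerD2l; apply: le_trans rhobe.
  have : (u l)%:R + 1 <= N%:R :> R by rewrite natr1 ler_nat.
  by rewrite -(ler_pM2l rho0) mulrDr mulr1; lra.
have xl l : c 0 l <= x 0 (lift ord0 l) <= c 0 l + rho / 2.
  by have := xb (lift ord0 l); rewrite /column_side liftK /= in_itv.
have := xb ord0; rewrite /column_side unlift_none /= in_itv/= => /andP[x0 x0'].
set C2 := \sum_l 2 * a 0 l * c 0 l in x0 x0'.
pose A2 := \sum_l 2 * a 0 l * x 0 (lift ord0 l).
have sumc (F : 'I_D.+1 -> R) b : (forall l, F l <= b) -> \sum_l F l <= m * b.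
  move=> Fb; apply: (@le_trans _ _ (\sum_(l < D.+1) b)); first exact: ler_sum.
  by rewrite sumr_const card_ord -[leLHS]mulr_natl.
have CA : C2 <= A2.
  apply: ler_sum => l _; have /andP[? _] := xl l.
  by rewrite ler_wpM2l// mulr_ge0.
have AC : A2 <= C2 + m * (2 * al * rho).
  rewrite -lerBlDl /A2 /C2 -sumrB; apply: sumc => l; rewrite -mulrBr.
  have /andP[_ h1] := xl l.
  apply: (@le_trans _ _ (2 * a 0 l * (rho / 2))).
    by rewrite ler_wpM2l ?mulr_ge0//; lra.
  rewrite (_ : 2 * a 0 l * (rho / 2) = a 0 l * rho); last by field.
  by rewrite ler_pM2r.
have Q : \sum_l (x 0 (lift ord0 l) - a 0 l) ^+ 2 <= m * (be / N%:R) ^+ 2.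
  apply: sumc => l; have /andP[h1 h2] := xl l; have := c0 l; have := ca l => h3 h4.
  by rewrite lerXn2r ?nnegrE ?subr_ge0//; lra.
have C2le : C2 <= m * (12 * al ^+ 2).
  apply: sumc => l; have h1 := c0 l; have h2 := ca l; have h3 := a0 l; have h4 := a2 l.
  apply: (@le_trans _ _ (2 * (2 * al) * (3 * al))); last by rewrite expr2; lra.
  by apply: ler_pM; rewrite ?mulr_ge0//; lra.
have hN : h = al ^+ 2 / 4 / N%:R ^+ 2 by rewrite /h /cap_height; field; rewrite gt_eqF.
have HN : H = al ^+ 2 / 32 / N%:R ^+ 2 by rewrite /H; field; rewrite gt_eqF.
have rN : m * (2 * al * rho) = al ^+ 2 / 16 / N%:R ^+ 2.
  rewrite (_ : _ * _ = 2 * al * (m * be) / N%:R ^+ 2); last by rewrite /rho;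
    field; rewrite gt_eqF.
  by rewrite mbe; field; rewrite gt_eqF.
have QN : m * (be / N%:R) ^+ 2 <= al ^+ 2 / 32 / N%:R ^+ 2.
  rewrite exprMn exprVn mulrA ler_pM2r ?invr_gt0// expr2 mulrA mbe.
  by rewrite expr2 mulrAC ler_pM2r// ler_pM2l.
have al6 : al <= 6^-1.
  by rewrite -mal ler_peMl// ltW.
have al2 : m * (12 * al ^+ 2) <= 3^-1.
  rewrite (_ : m * _ = 12 * (m * al) * al); last by ring.
  by rewrite mal; lra.
have hle : h <= al ^+ 2 / 4.
  by rewrite hN ler_pdivrMr// ler_peMr ?divr_ge0 ?exprn_ge0 ?(ltW al0)// exprn_ege1.
have all : al ^+ 2 <= 36^-1.
  by have : al * al <= 6^-1 * 6^-1 by [apply: ler_pM => //; exact: ltW];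
    rewrite expr2; lra.
have Sa0 : 0 <= dotp a a by exact: dotp_ge0.
have z0 : 0 <= al ^+ 2 / N%:R ^+ 2 by rewrite divr_ge0 ?exprn_ge0 ?ltW.
have /= sq := sum_sqr_dist a x; rewrite -/A2 in sq.
set z := al ^+ 2 / N%:R ^+ 2 in z0.
have ez r : al ^+ 2 / r / N%:R ^+ 2 = z / r by rewrite /z; ring.
rewrite !ez in hN HN rN QN.
split.
  by rewrite /paraboloid/=; apply/andP; split; lra.
rewrite /= dotp_cap_direction -/A2 -/h.
have : 0 <= h * dotp x x by rewrite mulr_ge0 ?dotp_ge0//; lra.
by lra.
Qed.

Lemma cap_box_disjoint N (j u u' : {ffun 'I_D.+1 -> 'I_N}) x : (0 < N)%N ->
  cap_box j u x -> cap_box j u' x -> u = u'.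
Proof.
move=> N0 ux u'x; apply/ffunP => l; apply/val_inj.
have r0 : 0 < be / N%:R ^+ 2 by rewrite divr_gt0 ?cap_mesh_gt0// exprn_gt0// ltr0n.
have close (i : {ffun 'I_D.+1 -> 'I_N}) : cap_box j i x ->
  cap_center j 0 l + be / N%:R ^+ 2 * (i l)%:R <=
    x 0 (lift ord0 l) <= cap_center j 0 l + be / N%:R ^+ 2 * (i l)%:R + be / N%:R
      ^+ 2 / 2.
  by move=> /(_ (lift ord0 l)); rewrite /column_side liftK /= in_itv/= mxE.
have := close _ ux; have := close _ u'x => /andP[h1 h2] /andP[h3 h4].
move: r0 h1 h2 h3 h4; set rho := be / _ => rho0 h1 h2 h3 h4.
have lt1 (p q : nat) : rho * p%:R - rho * q%:R < rho -> (p <= q)%N.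
  rewrite -mulrBr -[ltRHS]mulr1 ltr_pM2l// => h.
  by rewrite -ltnS -(ltr_nat R) -natr1; lra.
by apply/eqP; rewrite eqn_leq !lt1//; lra.
Qed.

Definition cap_volume_const : R := al ^+ 2 / 16 * (be / 2) ^+ D.+1.

Lemma cap_volume_const_gt0 : 0 < cap_volume_const.
Proof.
apply: mulr_gt0; first by rewrite divr_gt0 ?exprn_gt0 ?cap_spacing_gt0.
by rewrite exprn_gt0// divr_gt0 ?cap_mesh_gt0.
Qed.

(** The boxes over the [N ^ (D + 1)] subcells are disjoint. *)
Lemma lebesgue_grid_cap N (j : {ffun 'I_D.+1 -> 'I_N}) : (0 < N)%N ->
  ((cap_volume_const / N%:R ^+ D.+3)%:E <= lebesgue_rV (grid_cap j))%E.
Proof.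
move=> N0; have Np : 0 < N%:R :> R by rewrite ltr0n.
apply: le_trans (sum_measure_le (F := cap_box j) _ _ _ _ _); last 4 first.
- exact: measurable_paraboloid_cap.
- by move=> u; exact: measurable_column_box.
- by move=> u; exact: cap_box_sub.
- by move=> u u' x; exact: cap_box_disjoint.
rewrite (eq_bigr (fun=> (2 * (al ^+ 2 / (32 * N%:R ^+ 2)) *
   (be / N%:R ^+ 2 / 2) ^+ D.+1)%:E)); last first.
  move=> u _; rewrite /cap_box/= lebesgue_column_box//.
    by rewrite divr_ge0// divr_ge0 ?exprn_ge0// ltW// cap_mesh_gt0.
  by rewrite divr_ge0 ?mulr_ge0 ?exprn_ge0// ltW// cap_spacing_gt0.
rewrite sumEFin lee_fin sumr_const card_ffun !card_ord -[leRHS]mulr_natl natrX.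
rewrite le_eqVlt; apply/orP; left; apply/eqP; rewrite /cap_volume_const.
rewrite !exprMn !exprVn [N%:R ^+ D.+3](exprD _ 2 D.+1) -exprM mulnC exprM [(_ ^+
  D.+1) ^+ 2]expr2.
have D1 : 1 + D%:R != 0 :> R by rewrite gt_eqF// ltr_pwDl.
have Nu : N%:R != 0 :> R by rewrite gt_eqF.
have D2 : D.+1%:R != 0 :> R by [].
field; rewrite Nu D1 !expf_neq0 ?mulf_neq0//.
Qed.

End paraboloid_caps.

(** * Moments for uniform samples in the paraboloid *)

Section caps_probability.
Context (R : realType) (D : nat).

(** Choose in each cap the sample point that maximizes its strictly convex
    function; as the caps are disjoint, these vertices are distinct. *)
Lemma nb_vertices_ge_caps n (x : n.-tuple 'rV[R]_D.+2) N (S :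
  {set {ffun 'I_D.+1 -> 'I_N}}) :
  (0 < N)%N -> (forall i, @paraboloid R D (tnth x i)) ->
  (forall j, j \in S -> exists i, grid_cap j (tnth x i)) ->
  (#|S| <= nb_vertices x)%N.
Proof.
move=> N0 xP xS.
have key j : j \in S -> exists v, vertices (convex_hull [set` x]) v /\ grid_cap j v.
  move=> /xS[i0 [Pi0 /= ci0]].
  pose phi i := dotp (cap_direction (@cap_center R D N j)) (tnth x i) +
    cap_height R D N * dotp (tnth x i) (tnth x i).
  pose i := [arg max_(i > i0) phi i]%O.
  have imax k : phi k <= phi i by rewrite /i; case: arg_maxP => // i' _ h; exact: h.
  exists (tnth x i); split.
    apply: (argmax_vertex (cap_height_gt0 R D N0) (mem_tnth i x)).
    by move=> z /tnthP[k ->]; exact: imax.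
  by split; [exact: xP|exact: le_trans (imax i0)].
pose v (j : {ffun 'I_D.+1 -> 'I_N}) := xget 0 [set v | vertices (convex_hull
  [set` x]) v /\ grid_cap j v].
have vP j : j \in S -> vertices (convex_hull [set` x]) (v j) /\ grid_cap j (v j).
  by move=> /key; exact: (@xgetPex _ 0 [set v | vertices (convex_hull [set` x]) v
    /\ grid_cap j v]).
have fV : finite_set (vertices (convex_hull [set` x])).
  by apply: (sub_finite_set (@vertices_convex_hull _ _ [set` x])); exact: finite_seq.
rewrite cardE -(size_map v); apply: uniq_leq_size.
  rewrite map_inj_in_uniq ?enum_uniq// => j j'; rewrite !mem_enum => jS j'S vv.
  have [_ cj] := vP j jS; have [_ cj'] := vP j' j'S.
  by apply: (grid_cap_disjoint N0 cj); rewrite vv.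
move=> z /mapP[j]; rewrite mem_enum => jS ->.
by rewrite in_fset_set// mem_set//; have [] := vP j jS.
Qed.

Lemma uniform_law_sub (K : convex_body R D.+2) (A : set 'rV[R]_D.+2) : measurable A ->
  A `<=` K -> density_law (uniform_rV K) A = ((volume K)^-1%:E * lebesgue_rV A)%E.
Proof.
move=> mA AK; rewrite /density_law /=.
rewrite (eq_integral (fun x => (volume K)^-1%:E)) => [|x].
  by rewrite integral_cst.
by rewrite inE => Ax; rewrite /uniform_rV_pdf indicE mem_set ?mulr1//; exact: AK.
Qed.

Lemma uniform_law_body (K : convex_body R D.+2) : density_law (uniform_rV K) K = 1%E.
Proof.
rewrite uniform_law_sub//; last exact: measurable_body.
by rewrite -volumeE -EFinM mulVf// gt_eqF// volume_gt0.
Qed.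

Lemma volume_paraboloid : volume (paraboloid_body R D) <= 2 ^+ D.+2.
Proof.
rewrite -lee_fin volumeE.
apply: (@le_trans _ _ (lebesgue_rV (@cube R D))).
  apply: le_measure; rewrite ?inE.
  - exact: measurable_body.
  - exact: measurable_cube.
  - by move=> x /paraboloid_unit_ball; exact: unit_ball_cube.
rewrite /cube (lebesgue_rV_box (A := fun=> `[-1, 1]%classic)) => [|i];
  last exact: measurable_itv.
rewrite (eq_bigr (fun=> 2%:E)) => [|i _].
  by rewrite -(big_morph EFin EFinM erefl) prodr_const card_ord.
rewrite lebesgue_measure_itv/= lte_fin ifT; last by lra.
by rewrite -EFinD; congr EFin; lra.
Qed.

Definition cap_prob_const : R := cap_volume_const R D / 2 ^+ D.+2.

Lemma cap_prob_const_gt0 : 0 < cap_prob_const.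
Proof. by rewrite divr_gt0 ?cap_volume_const_gt0 ?exprn_gt0. Qed.

Local Notation P := (density_law (uniform_rV (paraboloid_body R D))).

Lemma grid_cap_prob N (j : {ffun 'I_D.+1 -> 'I_N}) : (0 < N)%N ->
  ((cap_prob_const / N%:R ^+ D.+3)%:E <= P (grid_cap j))%E.
Proof.
move=> N0; rewrite uniform_law_sub; last 2 first.
- exact: measurable_paraboloid_cap.
- by move=> x [].
apply: (@le_trans _ _ ((volume (paraboloid_body R D))^-1%:E *
  (cap_volume_const R D / N%:R ^+ D.+3)%:E)%E); last first.
  apply: lee_wpmul2l; last exact: lebesgue_grid_cap.
  by rewrite lee_fin invr_ge0 ltW// volume_gt0.
rewrite -EFinM lee_fin /cap_prob_const mulrAC [leRHS]mulrC.
rewrite ler_wpM2l//.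
  by rewrite divr_ge0 ?exprn_ge0// ltW// cap_volume_const_gt0.
by rewrite lef_pV2 ?posrE ?volume_gt0 ?exprn_gt0// volume_paraboloid.
Qed.

Section event.
Context (N n : nat) (N0 : (0 < N)%N).

(** All the points are required to be in the body, as the vertex provided by
    [argmax_vertex] is then in the body, and so in the cap. *)
Definition cap_hit (j : {ffun 'I_D.+1 -> 'I_N}) : set (n.-tuple 'rV[R]_D.+2) :=
  [set x | forall i, @paraboloid R D (tnth x i)] `\`
  [set x | forall i, (@paraboloid R D `\` grid_cap j) (tnth x i)].

Lemma measurable_cap_hit j : measurable (cap_hit j).
Proof.
have mK := measurable_body (paraboloid_body R D).
apply: measurableD.
  exact: (@measurable_box _ _ n (fun=> @paraboloid R D)).
apply: (@measurable_box _ _ n (fun=> @paraboloid R D `\` grid_cap j)) => i.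
by apply: measurableD => //; exact: measurable_paraboloid_cap.
Qed.

Lemma cap_hit_prob j :
  iid_law P n (cap_hit j) = (1 - (1 - fine (P (grid_cap j))) ^+ n)%:E.
Proof.
have mK : measurable (@paraboloid R D) := measurable_body (paraboloid_body R D).
have mC : measurable (@paraboloid R D `\` grid_cap j).
  by apply: measurableD => //; exact: measurable_paraboloid_cap.
have mKn : measurable [set x : n.-tuple 'rV[R]_D.+2 | forall i,
  @paraboloid R D (tnth x i)].
  exact: (@measurable_box _ _ n (fun=> @paraboloid R D)).
have mCn : measurable [set x : n.-tuple 'rV[R]_D.+2 | forall i,
  (@paraboloid R D `\` grid_cap j) (tnth x i)].
  exact: (@measurable_box _ _ n (fun=> @paraboloid R D `\` grid_cap j)).
rewrite /cap_hit measureD//; last by rewrite ltey_eq fin_num_measure.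
rewrite setIidr; last by move=> x h i; have [] := h i.
rewrite [X in (X - _)%E](_ : _ = 1%E); last first.
  rewrite [LHS](power_measure_box P (A := fun=> @paraboloid R D))//.
  by rewrite big1// => i _; exact: uniform_law_body.
have PC : P (@paraboloid R D `\` grid_cap j) = (1 - fine (P (grid_cap j)))%:E.
  rewrite measureD//; [|exact: measurable_paraboloid_cap|by rewrite ltey_eq
    fin_num_measure].
  rewrite setIidr; last by move=> x [].
  rewrite [X in (X - _)%E](uniform_law_body (paraboloid_body R D)) EFinB fineK//.
  by rewrite fin_num_measure//; exact: measurable_paraboloid_cap.
rewrite [X in (_ - X)%E](power_measure_box P (A := fun=>
  @paraboloid R D `\` grid_cap j))//.
rewrite (eq_bigr (fun=> (1 - fine (P (grid_cap j)))%:E)) => [|i _]; last exact: PC.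
by rewrite -(big_morph EFin EFinM erefl) prodr_const card_ord -EFinB.
Qed.

Lemma cap_hit_prob_ge j : (N ^ D.+3 <= n)%N ->
  ((cap_prob_const / (1 + cap_prob_const))%:E <= iid_law P n (cap_hit j))%E.
Proof.
move=> Nn; rewrite cap_hit_prob lee_fin.
have mG : measurable (@grid_cap R D N j) by exact: measurable_paraboloid_cap.
set p := fine _; have c0 := cap_prob_const_gt0; set c := cap_prob_const in c0 *.
have pc : c / N%:R ^+ D.+3 <= p.
  by rewrite -lee_fin fineK ?fin_num_measure//; exact: (grid_cap_prob j N0).
have Np : 0 < N%:R ^+ D.+3 :> R by rewrite exprn_gt0// ltr0n.
have p0 : 0 <= p by exact: fine_ge0.
have p1 : p <= 1.
  by rewrite -lee_fin fineK ?fin_num_measure//; exact: probability_le1.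
have np : c <= n%:R * p.
  apply: (@le_trans _ _ (N%:R ^+ D.+3 * p)).
    by rewrite -ler_pdivrMl// mulrC.
  by rewrite ler_wpM2r// -natrX ler_nat.
have bern : 1 + n%:R * p <= (1 + p) ^+ n.
  elim: (n) => [|k IH]; first by rewrite mul0r addr0 expr0.
  rewrite exprS -natr1; apply: (@le_trans _ _ ((1 + p) * (1 + k%:R * p))).
    have : 0 <= p * (k%:R * p) by rewrite !mulr_ge0.
    by lra.
  by rewrite ler_wpM2l// addr_ge0.
have h : (1 - p) ^+ n * (1 + c) <= 1.
  apply: (@le_trans _ _ ((1 - p) ^+ n * (1 + p) ^+ n)).
    by rewrite ler_wpM2l ?exprn_ge0 ?subr_ge0//; lra.
  rewrite -exprMn exprn_ile1//; last by nra.
  by rewrite mulr_ge0 ?subr_ge0// addr_ge0.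
have c1 : 0 < 1 + c by lra.
rewrite ler_pdivrMr// mulrBl; lra.
Qed.

(** The number [Y] of caps hit is a measurable lower bound of the number of
    vertices; its [q]-th moment is bounded below by its mean, through the convexity
    inequality [s ^ (q - 1) Y <= Y ^ q + s ^ q] with [s] half of the
    lower bound on the mean. *)
Lemma moment_nb_vertices_lower q : (0 < q)%N -> (N ^ D.+3 <= n)%N ->
  (((cap_prob_const / (1 + cap_prob_const) / 2) ^+ q * (N ^ D.+1)%:R ^+ q)%:E <=
    moment_nb_vertices (uniform_rV (paraboloid_body R D)) n q)%E.
Proof.
move=> q0 Nn; set c := cap_prob_const / (1 + cap_prob_const).
have c0 : 0 <= c.
  have := cap_prob_const_gt0; rewrite /c; move: cap_prob_const => k k0.
  by apply: divr_ge0; lra.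
pose Y (x : n.-tuple 'rV[R]_D.+2) : R := \sum_(j : {ffun 'I_D.+1 ->
  'I_N}) \1_(cap_hit j) x.
have Y0 x : 0 <= Y x by apply: sumr_ge0 => j _.
have mY : measurable_fun setT Y.
  by apply: measurable_sum => j; apply: measurable_indic; exact: measurable_cap_hit.
have YR x : Y x <= (nb_vertices x)%:R.
  have [[j0 j0x]|nj] := pselect (exists j, cap_hit j x); last first.
    rewrite /Y big1 ?ler0n// => j _; rewrite indicE memNset// => jx.
    by apply: nj; exists j.
  pose S := finset (fun j : {ffun 'I_D.+1 -> 'I_N} => x \in cap_hit j).
  have -> : Y x = #|S|%:R.
    rewrite /Y -sum1_card natr_sum [RHS]big_mkcond/=; apply: eq_bigr => j _.
    by rewrite indicE /S finset.inE; case: (_ \in _).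
  rewrite ler_nat; apply: nb_vertices_ge_caps => //; first by have [] := j0x.
  move=> j; rewrite /S finset.inE => /set_mem[xK /= xC].
  apply: contrapT => /forallNP nC; apply: xC => i; split; first exact: xK.
  exact: nC.
rewrite /moment_nb_vertices unlock.
apply: (@le_trans _ _ (\int[iid_law P n]_x (Y x ^+ q)%:E)%E); last first.
  apply: le_lower_integral => x; rewrite lee_fin ?exprn_ge0//.
  by rewrite lerXn2r ?nnegrE.
have mYq : measurable_fun setT (fun x => (Y x ^+ q)%:E).
  by apply/measurable_EFinP; apply: measurable_funX.
pose m : R := (N ^ D.+1)%:R; have m0 : 0 <= m by rewrite ler0n.
pose s := c / 2 * m; have s0 : 0 <= s by rewrite mulr_ge0// divr_ge0.
have EY : ((c * m)%:E <= \int[iid_law P n]_x (Y x)%:E)%E.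
  under eq_integral do rewrite /Y -sumEFin.
  rewrite ge0_integral_sum//=; last first.
    by move=> j; apply/measurable_EFinP; apply: measurable_indic;
      exact: measurable_cap_hit.
  apply: (@le_trans _ _ (\sum_(j : {ffun 'I_D.+1 -> 'I_N}) c%:E)%E).
    by rewrite sumEFin sumr_const card_ffun !card_ord -[in leRHS]mulr_natr.
  apply: lee_sum => j _; rewrite integral_indic ?setIT//;
    last exact: measurable_cap_hit.
  exact: cap_hit_prob_ge.
have expq z : z ^+ q = z * z ^+ q.-1 :> R by rewrite -exprS prednK.
have pw x : s ^+ q.-1 * Y x <= Y x ^+ q + s ^+ q.
  rewrite (expq (Y x)) (expq s); have [sY|Ys] := leP s (Y x).
    apply: ler_wpDr; first by rewrite mulr_ge0// exprn_ge0.
    by rewrite mulrC ler_wpM2l// lerXn2r ?nnegrE.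
  apply: ler_wpDl; first by rewrite mulr_ge0// exprn_ge0.
  by rewrite mulrC ler_wpM2r ?exprn_ge0// ltW.
have : (\int[iid_law P n]_x (s ^+ q.-1 * Y x)%:E <= \int[iid_law P n]_x (Y x ^+ q
  + s ^+ q)%:E)%E.
  by apply: le_lower_integral => x; rewrite lee_fin// mulr_ge0 ?exprn_ge0.
under eq_integral do rewrite EFinM.
under [X in (_ <= X)%E -> _]eq_integral do rewrite EFinD.
have mYE : measurable_fun setT (fun x => (Y x)%:E) by exact/measurable_EFinP.
have sE : (0 <= (s ^+ q.-1)%:E)%E by rewrite lee_fin exprn_ge0.
rewrite ge0_integralZl//; last by move=> x _; rewrite lee_fin.
rewrite ge0_integralD//; [|by move=> x _;
  rewrite lee_fin exprn_ge0|by move=> x _; rewrite lee_fin exprn_ge0].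
rewrite integral_cst// [X in (_ <= _ + _ * X)%E -> _](_ : _ = 1%E);
  last exact: probability_setT.
rewrite mule1 => h.
have h2 : ((s ^+ q.-1 * (c * m))%:E <= \int[iid_law P n]_x (Y x ^+ q)%:E + (s ^+
  q)%:E)%E.
  by apply: le_trans h; rewrite EFinM; exact: lee_wpmul2l.
rewrite -exprMn -/s.
have e : s ^+ q.-1 * (c * m) = s ^+ q + s ^+ q.
  by rewrite (expq s) (_ : c * m = s + s); [ring|rewrite /s; field].
by move: h2; rewrite e EFinD leeD2rE.
Qed.

End event.
End caps_probability.

(** * Comparison of the suprema *)

Lemma nnsup_le (R : realType) (A : set (\bar R)) (b : R) : 0 <= b ->
  (forall y, A y -> (y <= b%:E)%E) -> (nnsup A <= b%:E)%E.
Proof.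
move=> b0 Ab; rewrite /nnsup; case: ifPn => _; first by rewrite lee_fin.
exact: ge_ereal_sup.
Qed.

Theorem theorem6 (R : realType) (d : nat) (M : R) (q : nat) :
  (2 <= d)%N -> 0 < M -> (0 < q)%N ->
  exists C : R, forall n : nat, (1 <= n)%N ->
    (nnsup [set nnsup [set moment_nb_vertices f n q | f in bounded_densities K M]
          | K in @unit_bodies R d]
     <= C%:E * nnsup [set moment_nb_vertices (uniform_rV K) n q
                   | K in @unit_bodies R d])%E.
Proof.
case: d => [//|[//|D]] _ M0 q0.
have [U UP] := moment_nb_vertices_upper D M0 q0.
have k0 := cap_prob_const_gt0 R D.
set k := cap_prob_const R D in k0.
pose c := (k / (1 + k) / 2) ^+ q.
have k1 : 0 < 1 + k by lra.
have c0 : 0 < c by rewrite exprn_gt0// divr_gt0// divr_gt0.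
pose U' := Num.max U 0.
have U'0 : 0 <= U' by rewrite le_max lexx orbT.
exists (U' / c) => n n0.
(* [N] is the integer part of the root of order [D + 3] of [n] *)
have [N [N0 Nn nN]] : exists N, [/\ (0 < N)%N, (N ^ D.+3 <= n)%N & (n < N.+1 ^ D.+3)%N].
  have ex1 : exists N, (N ^ D.+3 <= n)%N by exists 0%N; rewrite exp0n.
  have ub N : (N ^ D.+3 <= n)%N -> (N <= n)%N.
    apply: leq_trans; case: N => // N.
    by rewrite -{1}[N.+1]expn1 leq_pexp2l.
  case: (ex_maxnP ex1 ub) => N Nn Nmax; exists N; split => //.
    by apply: Nmax; rewrite exp1n.
  by rewrite ltnNge; apply/negP => /Nmax; rewrite ltnn.
pose t : R := (N ^ D.+1)%:R ^+ q.
have t0 : 0 <= t by rewrite exprn_ge0.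
have lower : ((c * t)%:E <= nnsup [set moment_nb_vertices (uniform_rV K) n q
    | K in @unit_bodies R D.+2])%E.
  have /le_trans := @moment_nb_vertices_lower R D N n N0 q q0 Nn; apply.
  rewrite /nnsup; case: ifPn => [/eqP e|_].
    have : set0 (moment_nb_vertices (uniform_rV (paraboloid_body R D)) n q).
      rewrite -e; exists (paraboloid_body R D) => //.
      exact: (@paraboloid_unit_ball R D).
    by [].
  apply: ereal_sup_ubound; exists (paraboloid_body R D) => //.
  exact: (@paraboloid_unit_ball R D).
apply: (@le_trans _ _ (U' * t)%:E).
  apply: nnsup_le => [|_ [K Kb <-]]; first by rewrite mulr_ge0.
  apply: nnsup_le => [|_ [f fK <-]]; first by rewrite mulr_ge0.
  apply: (le_trans (UP N n K f N0 nN Kb _)); first by rewrite inE.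
  by rewrite lee_fin ler_wpM2r// le_max lexx.
have -> : (U' * t)%:E = ((U' / c)%:E * (c * t)%:E)%E.
  by rewrite -EFinM mulrA divfK// gt_eqF.
by apply: lee_wpmul2l => //; rewrite lee_fin divr_ge0// ltW.
Qed.
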